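(* Fix $C_1,C_2$ with $2C_1+C_2>0$, and let $$b_1=\Big(-1+\frac{\sqrt6}{3}\Big)C_1^2+\Big(-\frac32+\frac{\sqrt6}{3}\Big)C_1C_2+\Big(-\frac18+\frac{\sqrt6}{12}\Big)C_2^2.$$ Consider the period function $\mathfrak L(C_1,C_2,C_3,b)$ as a function of $C_3$, for fixed $b$, on the set of $C_3\in(0,C_{3,crit})$ with $b_-(C_3)<b<b_+(C_3)$. Then: (i) if $b\in(-\frac12C_1^2-C_1C_2,\ b_1)$, $\mathfrak L$ is monotonically increasing in $C_3$; (ii) if $b\in(b_1,\ \frac18(C_2^2-4C_1C_2))$, $\mathfrak L$ has a single maximum point in $C_3$; (iii) if $b\in(\frac18(C_2^2-4C_1C_2),\ \frac16(C_1-C_2)^2)$, $\mathfrak L$ is monotonically decreasing in $C_3$.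
   Context: Let real constants $C_1,C_2$ be given with $2C_1+C_2>0$, and let $C_{3,crit}=\frac1{27}(2C_1+C_2)^3$. For $C_3\in(0,C_{3,crit})$, let $\phi_1<\phi_2<\phi_3$ be the roots of $2(\phi-C_1)^2(\phi+\frac{C_2}2)=C_3$; they satisfy $-\frac{C_2}{2}<\phi_1<\frac{C_1-C_2}{3}<\phi_2<C_1<\phi_3$. Let $U(\phi)=-\frac12\phi^2-\frac12C_2\phi-\frac12C_1C_2-\frac{C_3}{2(\phi-C_1)}$. Set $b_-(C_3)=U(\phi_2)$ and $b_+(C_3)=U(\phi_1)$. For $b\in(b_-(C_3),b_+(C_3))$, let $\phi_-<\phi_+$ be the two solutions of $U(\phi)=b$ with $\phi_1<\phi_-<\phi_2<\phi_+<C_1$. Define $$\mathfrak L(C_1,C_2,C_3,b)=2\int_{\phi_-}^{\phi_+}\frac{d\phi}{\sqrt{2(b-U(\phi))}}.$$ This is the period of the periodic orbit of $\frac12\dot\phi^2+U(\phi)=b$, which describes travelling waves of the DGH equation. *)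

(* Defs.v *)
From Stdlib Require Import Reals Lra ClassicalEpsilon.
From Coquelicot Require Import Coquelicot.
Open Scope R_scope.

Definition C3crit (C1 C2 : R) : R := (2*C1 + C2)^3 / 27.

Definition cubicF (C1 C2 phi : R) : R := 2 * (phi - C1)^2 * (phi + C2/2).

Definition U (C1 C2 C3 phi : R) : R :=
  - (1/2) * phi^2 - (1/2) * C2 * phi - (1/2) * C1 * C2 - C3 / (2 * (phi - C1)).

Definition phi1 (C1 C2 C3 : R) : R :=
  epsilon (inhabits 0) (fun p => - C2/2 < p < (C1 - C2)/3 /\ cubicF C1 C2 p = C3).

Definition phi2 (C1 C2 C3 : R) : R :=
  epsilon (inhabits 0) (fun p => (C1 - C2)/3 < p < C1 /\ cubicF C1 C2 p = C3).

Definition b_minus (C1 C2 C3 : R) : R := U C1 C2 C3 (phi2 C1 C2 C3).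
Definition b_plus  (C1 C2 C3 : R) : R := U C1 C2 C3 (phi1 C1 C2 C3).

Definition phi_minus (C1 C2 C3 b : R) : R :=
  epsilon (inhabits 0)
    (fun p => phi1 C1 C2 C3 < p < phi2 C1 C2 C3 /\ U C1 C2 C3 p = b).
Definition phi_plus (C1 C2 C3 b : R) : R :=
  epsilon (inhabits 0)
    (fun p => phi2 C1 C2 C3 < p < C1 /\ U C1 C2 C3 p = b).

Definition period (C1 C2 C3 b : R) : R :=
  2 * RInt_gen (fun phi => 1 / sqrt (2 * (b - U C1 C2 C3 phi)))
                (at_right (phi_minus C1 C2 C3 b)) (at_left (phi_plus C1 C2 C3 b)).

Definition admissible (C1 C2 b C3 : R) : Prop :=
  0 < C3 < C3crit C1 C2 /\ b_minus C1 C2 C3 < b < b_plus C1 C2 C3.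

Definition b_1 (C1 C2 : R) : R :=
  (-1 + sqrt 6 / 3) * C1^2 + (-3/2 + sqrt 6 / 3) * C1 * C2
  + (-1/8 + sqrt 6 / 12) * C2^2.

(* Main.v *)
Require Import Defs.
From Stdlib Require Import Reals Lra Psatz ClassicalEpsilon Ranalysis5.
From Coquelicot Require Import Coquelicot.
Open Scope R_scope.

(** After an affine change of variables the orbits of a fixed energy are indexed by the half-width d
    of the wave, C3 is a decreasing function of d, and the period is a complete elliptic integral
    T(d).  Its derivative is T' = 2 G / (d rad) with G of the second kind, and reducing G' modulo
    exact forms gives a first-order linear equation whose inhomogeneity is a positive integral times
    [excess], an increasing affine function of C3.  Hence an explicit positive multiple W of G, which
    vanishes at the centre d = 0, is monotone as long as the excess keeps its sign.  The excess is
    positive on the whole level in case (iii), negative in case (i), and in case (ii) passes from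
    positive to negative as d grows; there W tends to minus infinity at the peaked end C3 = 0, so
    that it has exactly one zero. *)

(** G cannot be signed under the integral: its integrand is a positive function times d (d + [coefB]
    cos t), which changes sign in t already for small d > 0. This is why G is controlled through its
    own derivative, starting from the value 0 at the centre. The thresholds in b come from the two
    ends of a level. At the centre the excess has the sign of 5 - 2 sqrt K - K, which vanishes for
    sqrt K = sqrt 6 - 1, that is, for b = [b_1]. The other end depends on K: for K < 1 the two
    larger roots meet first (a solitary wave) and the product of the roots stays away from 0; for 1
    < K < 4 the smallest root reaches 0 first, and an excess evaluated at C3 = 0 is negative. The
    value K = 1 is b = (C2^2 - 4 C1 C2)/8. In case (ii) a negative excess near the peaked end does
    not by itself bring W below 0. What does is the power of C3 in the weight: its exponent (1 -
    K)/(3K) is negative, so the decrease of W accumulates without bound. *)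

Lemma cts_plus {T : UniformSpace} (f g : T -> R) x :
  continuous f x -> continuous g x -> continuous (fun y => f y + g y) x.
Proof. intros; now apply (continuous_plus f g). Qed.

Lemma cts_minus {T : UniformSpace} (f g : T -> R) x :
  continuous f x -> continuous g x -> continuous (fun y => f y - g y) x.
Proof. intros; now apply (continuous_minus f g). Qed.

Lemma cts_opp {T : UniformSpace} (f : T -> R) x :
  continuous f x -> continuous (fun y => - f y) x.
Proof. intros; now apply (continuous_opp f). Qed.

Lemma cts_mult {T : UniformSpace} (f g : T -> R) x :
  continuous f x -> continuous g x -> continuous (fun y => f y * g y) x.
Proof. intros; now apply (continuous_mult f g). Qed.

Lemma cts_div {T : UniformSpace} (f g : T -> R) x :
  continuous f x -> continuous g x -> g x <> 0 -> continuous (fun y => f y / g y) x.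
Proof. intros Hf Hg H0; apply cts_mult; trivial; exact (continuous_comp g Rinv x Hg (continuous_Rinv _ H0)). Qed.

Lemma cts_sqrt {T : UniformSpace} (f : T -> R) x :
  continuous f x -> continuous (fun y => sqrt (f y)) x.
Proof. intros Hf; exact (continuous_comp f sqrt x Hf (continuous_sqrt _)). Qed.

Lemma cts_pos_locally (f : R -> R) x : continuous f x -> 0 < f x -> locally x (fun y => 0 < f y).
Proof.
intros Hf Hp. apply (Hf (fun z => 0 < z)).
apply (open_gt 0). exact Hp.
Qed.

Lemma ex_RInt_cts (f : R -> R) a b : (forall t, continuous f t) -> ex_RInt f a b.
Proof. intros H. apply (ex_RInt_continuous (V := R_CompleteNormedModule)). intros; apply H. Qed.

Lemma is_derive_under_RInt (f f' : R -> R -> R) (a b x : R) :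
  locally x (fun y => forall t, is_derive (fun u => f u t) y (f' y t)) ->
  locally x (fun y => forall t, continuous (f y) t) ->
  (forall t, continuous (fun z : R * R => f' (fst z) (snd z)) (x, t)) ->
  is_derive (fun y => RInt (f y) a b) x (RInt (f' x) a b).
Proof.
intros Hd Hc H2.
replace (RInt (f' x) a b) with (RInt (fun t => Derive (fun u => f u t) x) a b).
2: { apply RInt_ext; intros t _. apply is_derive_unique.
     exact (locally_singleton _ _ Hd t). }
apply is_derive_RInt_param.
- refine (filter_imp _ _ _ Hd); intros y Hy t _. exists (f' y t). apply Hy.
- intros t _.
  apply (continuity_2d_pt_ext_loc f').
  + destruct Hd as [e He]. exists e. intros u v Hu Hv. symmetry. apply is_derive_unique.
    apply He. exact Hu.
  + apply continuity_2d_pt_filterlim. apply H2.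
- refine (filter_imp _ _ _ Hc); intros y Hy. now apply ex_RInt_cts.
Qed.

(** With a = C1 + C2/2 and phi = C1 - a y, the orbits of energy b are given by the cubic
    y^3 - 2 y^2 + (4 - K)/3 y - C3/a^3, where K = [level C1 C2 b].  Its roots are
    mid - d < mid + d < mid + rad with rad^2 + 3 d^2 = K, so that for fixed K they are
    parametrized by the half-width d.  Along y = mid + d cos t, [wave] is y and [gap] is the
    distance to the largest root. *)
Definition rad (K d : R) : R := sqrt (K - 3 * d^2).
Definition mid (K d : R) : R := (2 - rad K d) / 3.
Definition wave (K d t : R) : R := mid K d + d * cos t.
Definition gap (K d t : R) : R := rad K d - d * cos t.
Definition dens (K d t : R) : R := / sqrt (wave K d t * gap K d t).
(** The first inequality keeps the two larger roots apart, the second keeps the smallest root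
    positive. Absolute values make the set a neighbourhood of the centre d = 0, so that derivatives
    are available there as well. *)
Definition orbit (K d : R) : Prop := Rabs d < rad K d /\ Rabs d < mid K d.

(** * Roots and density as functions of the half-width *)

Lemma orbit_rad K d : orbit K d -> 0 < rad K d /\ rad K d ^ 2 = K - 3 * d^2.
Proof.
intros [H1 _]. pose proof (Rabs_pos d) as H0.
assert (H : 0 < rad K d) by lra. split; trivial.
unfold rad in *. apply pow2_sqrt.
destruct (Rle_lt_dec 0 (K - 3*d^2)); trivial. rewrite sqrt_neg_0 in H; lra.
Qed.

Lemma orbit_bounds K d : orbit K d ->
  -rad K d < d < rad K d /\ - mid K d < d < mid K d.
Proof. intros [H1 H2]. apply Rabs_def2 in H1, H2. lra. Qed.

Lemma orbit_open K d : orbit K d -> locally d (orbit K).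
Proof.
intros Ho. pose proof (orbit_rad _ _ Ho) as [Hr Hr2]. destruct Ho as [H1 H2].
assert (Hc : continuous (rad K) d).
{ apply (cts_sqrt (fun d => K - 3 * d^2)).
  apply (ex_derive_continuous (fun d => K - 3 * d^2)). now auto_derive. }
apply filter_and.
- assert (H : 0 < rad K d - Rabs d) by lra.
  apply (cts_pos_locally (fun d => rad K d - Rabs d)) in H.
  + eapply filter_imp; [|exact H]; intros y; simpl; lra.
  + apply cts_minus; trivial. apply continuous_Rabs.
- assert (H : 0 < mid K d - Rabs d) by lra.
  apply (cts_pos_locally (fun d => mid K d - Rabs d)) in H.
  + eapply filter_imp; [|exact H]; intros y; simpl; lra.
  + apply cts_minus; [|apply continuous_Rabs].
    apply (cts_div (fun d => 2 - rad K d) (fun _ => 3)); try apply continuous_const; try lra.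
    apply cts_minus; trivial; apply continuous_const.
Qed.

Lemma orbit_pos K d t : orbit K d -> 0 < wave K d t /\ 0 < gap K d t.
Proof.
intros Ho. apply orbit_bounds in Ho. pose proof (COS_bound t) as Hc. unfold wave, gap.
split; destruct (Rle_lt_dec 0 d); nra.
Qed.

Lemma is_derive_rad K d : orbit K d -> is_derive (rad K) d (- 3 * d / rad K d).
Proof.
intros Ho. apply orbit_rad in Ho. destruct Ho as [Hr Hr2].
assert (H : 0 < K - 3 * d^2) by (rewrite <- Hr2; nra).
unfold rad in *. auto_derive.
- lra.
- replace (K + - (3 * (d * (d * 1)))) with (K - 3 * d^2) by ring. field. lra.
Qed.

Lemma is_derive_mid K d : orbit K d -> is_derive (mid K) d (d / rad K d).
Proof.
intros Ho. pose proof (is_derive_rad _ _ Ho) as Hd. apply orbit_rad in Ho. unfold mid.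
auto_derive.
- eexists; exact Hd.
- replace (Derive (fun x => rad K x) d) with (-3 * d / rad K d)
    by (symmetry; now apply is_derive_unique). field. lra.
Qed.

Lemma is_derive_wave K d t : orbit K d ->
  is_derive (fun u => wave K u t) d (d / rad K d + cos t).
Proof.
intros Ho. pose proof (is_derive_mid _ _ Ho) as Hd. unfold wave.
auto_derive.
- eexists; exact Hd.
- replace (Derive (fun x => mid K x) d) with (d / rad K d)
    by (symmetry; now apply is_derive_unique). ring.
Qed.

Lemma is_derive_gap K d t : orbit K d ->
  is_derive (fun u => gap K u t) d (- (3 * d / rad K d + cos t)).
Proof.
intros Ho. pose proof (is_derive_rad _ _ Ho) as Hd. unfold gap.
apply orbit_rad in Ho. auto_derive.
- eexists; exact Hd.
- replace (Derive (fun x => rad K x) d) with (-3 * d / rad K d)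
    by (symmetry; now apply is_derive_unique). field; lra.
Qed.

Lemma is_derive_invsqrt (n m : R -> R) (n' m' x : R) : 0 < n x -> 0 < m x ->
  is_derive n x n' -> is_derive m x m' ->
  is_derive (fun u => / sqrt (n u * m u)) x
    (- (1/2) * (n' / n x + m' / m x) * / sqrt (n x * m x)).
Proof.
intros Hn Hm Dn Dm. assert (H : 0 < n x * m x) by now apply Rmult_lt_0_compat.
assert (Hs := sqrt_lt_R0 _ H).
auto_derive.
- repeat split; trivial; try (eexists; eassumption). lra.
- replace (Derive (fun u => n u) x) with n' by (symmetry; now apply is_derive_unique).
  replace (Derive (fun u => m u) x) with m' by (symmetry; now apply is_derive_unique).
  rewrite (sqrt_sqrt _ (Rlt_le _ _ H)).
  field. repeat split; lra.
Qed.

Lemma is_derive_dens K d t : orbit K d ->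
  is_derive (fun u => dens K u t) d
    (- (1/2) * ((d / rad K d + cos t) / wave K d t
                - (3 * d / rad K d + cos t) / gap K d t) * dens K d t).
Proof.
intros Ho. pose proof (orbit_pos _ _ t Ho) as [Hw Hg].
evar_last. apply (is_derive_invsqrt (fun u => wave K u t) (fun u => gap K u t) _ _ _ Hw Hg (is_derive_wave _ _ t Ho) (is_derive_gap _ _ t Ho)).
unfold dens, Rdiv. ring.
Qed.

Lemma is_derive_dens_angle K d t : orbit K d ->
  is_derive (dens K d) t
    ((1/2) * d * sin t * (/ wave K d t - / gap K d t) * dens K d t).
Proof.
intros Ho. pose proof (orbit_pos _ _ t Ho) as [Hw Hg].
assert (D1 : is_derive (wave K d) t (- d * sin t)).
{ unfold wave. auto_derive; trivial. ring. }
assert (D2 : is_derive (gap K d) t (d * sin t)).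
{ unfold gap. auto_derive; trivial. ring. }
evar_last. apply (is_derive_invsqrt (wave K d) (gap K d) _ _ _ Hw Hg D1 D2).
unfold dens, Rdiv. field. split; [|split]; try lra. apply Rgt_not_eq, sqrt_lt_R0. nra.
Qed.

(** * Joint continuity in half-width and angle *)

Lemma cts_fst (x : R * R) : continuous (fun z : R * R => fst z) x.
Proof. destruct x. apply continuous_fst. Qed.

Lemma cts_cos_snd (x : R * R) : continuous (fun z : R * R => cos (snd z)) x.
Proof. apply (continuous_comp snd cos). destruct x; apply continuous_snd. apply continuous_cos. Qed.

Lemma cts_rad_fst K x : orbit K (fst x) -> continuous (fun z : R * R => rad K (fst z)) x.
Proof.
intros Ho. apply (continuous_comp fst (rad K)). destruct x; apply continuous_fst.
apply @ex_derive_continuous. eexists. apply is_derive_rad. exact Ho.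
Qed.

Lemma cts_mid_fst K x : orbit K (fst x) -> continuous (fun z : R * R => mid K (fst z)) x.
Proof.
intros Ho. apply (continuous_comp fst (mid K)). destruct x; apply continuous_fst.
apply @ex_derive_continuous. eexists. apply is_derive_mid. exact Ho.
Qed.

Lemma cts_wave K (x : R * R) : orbit K (fst x) -> continuous (fun z : R * R => wave K (fst z) (snd z)) x.
Proof. intros Ho. apply cts_plus. now apply cts_mid_fst. apply cts_mult. apply cts_fst. apply cts_cos_snd. Qed.

Lemma cts_gap K (x : R * R) : orbit K (fst x) -> continuous (fun z : R * R => gap K (fst z) (snd z)) x.
Proof. intros Ho. apply cts_minus. now apply cts_rad_fst. apply cts_mult. apply cts_fst. apply cts_cos_snd. Qed.

Lemma cts_dens K (x : R * R) : orbit K (fst x) -> continuous (fun z : R * R => dens K (fst z) (snd z)) x.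
Proof.
intros Ho. pose proof (orbit_pos _ _ (snd x) Ho) as [Hw Hg]. unfold dens.
apply (continuous_comp (fun z : R * R => sqrt (wave K (fst z) (snd z) * gap K (fst z) (snd z))) Rinv).
apply cts_sqrt, cts_mult. now apply cts_wave. now apply cts_gap.
apply continuous_Rinv. apply Rgt_not_eq, sqrt_lt_R0. nra.
Qed.

Lemma cts_angle (f : R -> R -> R) d t :
  continuous (fun z : R * R => f (fst z) (snd z)) (d, t) -> continuous (f d) t.
Proof.
intros H. apply (continuous_comp_2 (fun _ => d) (fun t => t) f).
apply continuous_const. apply continuous_id. exact H.
Qed.

Lemma cts_pow {T : UniformSpace} (f : T -> R) n x :
  continuous f x -> continuous (fun y => f y ^ n) x.
Proof.
intros H. induction n as [|n IH]; [apply continuous_const|]. now apply cts_mult.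
Qed.

(** Half of [wave + gap], hence half of the largest root; it also equals [1 - mid]. *)
Definition half_sum (K d : R) : R := (1 + rad K d) / 3.
(** The d-derivative of [wave * dens] is (d + [coefB] cos t) / ([rad] [gap]) times [dens]. *)
Definition coefB (K d : R) : R := d^2 + rad K d * half_sum K d.

Lemma cts_half_sum_fst K (x : R * R) : orbit K (fst x) ->
  continuous (fun z : R * R => half_sum K (fst z)) x.
Proof.
intros Ho. apply cts_div; [|apply continuous_const|lra].
apply cts_plus; [apply continuous_const|now apply cts_rad_fst].
Qed.

Lemma cts_coefB_fst K (x : R * R) : orbit K (fst x) ->
  continuous (fun z : R * R => coefB K (fst z)) x.
Proof.
intros Ho. apply cts_plus; [apply cts_pow, cts_fst|].
apply cts_mult; [now apply cts_rad_fst | now apply cts_half_sum_fst].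
Qed.

Ltac cts := repeat lazymatch goal with
  | |- continuous (fun z => Rdiv (@?f z) (@?g z)) _ => apply (cts_div f g)
  | |- continuous (fun z => Rmult (@?f z) (@?g z)) _ => apply (cts_mult f g)
  | |- continuous (fun z => Rplus (@?f z) (@?g z)) _ => apply (cts_plus f g)
  | |- continuous (fun z => Rminus (@?f z) (@?g z)) _ => apply (cts_minus f g)
  | |- continuous (fun z => Ropp (@?f z)) _ => apply (cts_opp f)
  | |- continuous (fun z => pow (@?f z) ?n) _ => apply (cts_pow f n)
  | |- continuous (fun z => wave ?K (fst z) (snd z)) _ => apply (cts_wave K)
  | |- continuous (fun z => gap ?K (fst z) (snd z)) _ => apply (cts_gap K)
  | |- continuous (fun z => dens ?K (fst z) (snd z)) _ => apply (cts_dens K)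
  | |- continuous (fun z => rad ?K (fst z)) _ => apply (cts_rad_fst K)
  | |- continuous (fun z => mid ?K (fst z)) _ => apply (cts_mid_fst K)
  | |- continuous (fun z => half_sum ?K (fst z)) _ => apply (cts_half_sum_fst K)
  | |- continuous (fun z => coefB ?K (fst z)) _ => apply (cts_coefB_fst K)
  | |- continuous (fun z => cos (snd z)) _ => apply cts_cos_snd
  | |- continuous (fun z => fst z) _ => apply cts_fst
  | |- continuous (fun z => ?c) _ => apply continuous_const
  end.

(** [flux] is the product of the three roots, that is C3/a^3; [slope] is the d-derivative of the
    scaled period up to the positive factor 2/(d rad); [excess] decides the sign of its weighted
    derivative, see [is_derive_wslope]. *)
Definition flux (K d : R) : R := 2 * half_sum K d * (mid K d ^ 2 - d^2).
Definition excess (K c : R) : R := (1 + K) * c - 2/27 * (K - 1)^2 * (4 - K).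
Definition slope_dens (K d t : R) : R :=
  (half_sum K d * K - coefB K d * gap K d t) / gap K d t * dens K d t.
Definition slope (K d : R) : R := RInt (slope_dens K d) 0 PI.
Definition dens_int (K d : R) : R := RInt (dens K d) 0 PI.
Definition scaled_period (K d : R) : R := 2 * RInt (fun t => wave K d t * dens K d t) 0 PI.

(** * Derivative of the period and the linear equation for [slope] *)

Lemma is_derive_scaled_period K d : orbit K d -> d <> 0 ->
  is_derive (scaled_period K) d (2 / (d * rad K d) * slope K d).
Proof.
intros Ho Hd0. pose proof (orbit_open _ _ Ho) as Hl.
pose proof (orbit_rad _ _ Ho) as [Hr Hr2].
set (f' := fun u t => (u + coefB K u * cos t) / (rad K u * gap K u t) * dens K u t).
assert (D : is_derive (fun u => RInt (fun t => wave K u t * dens K u t) 0 PI) d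
              (RInt (f' d) 0 PI)).
{ apply (is_derive_under_RInt (fun u t => wave K u t * dens K u t)).
  - eapply filter_imp; [|exact Hl]. clear - K. intros d Ho t.
    pose proof (orbit_rad _ _ Ho) as [Hr Hr2]. pose proof (orbit_pos _ _ t Ho) as [Hw Hg].
    evar_last.
    { apply (is_derive_mult (fun u => wave K u t) (fun u => dens K u t)).
      now apply is_derive_wave. now apply is_derive_dens. intros; apply Rmult_comm. }
    unfold f', plus, mult; simpl.
    unfold coefB, half_sum.
    transitivity ((d / rad K d + cos t - (1/2) * (d / rad K d + cos t) +
      (1/2) * wave K d t * (3 * d / rad K d + cos t) / gap K d t) * dens K d t).
    { field. repeat split; lra. }
    f_equal. unfold wave, gap, mid in *. field. repeat split; try lra.
  - eapply filter_imp; [|exact Hl]. intros y Hy t.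
    apply (cts_angle (fun y t => wave K y t * dens K y t)). cts; trivial.
  - intros t. pose proof (orbit_pos _ _ t Ho) as [Hw Hg]. unfold f'.
    cts; trivial; simpl; try lra. nra. }
assert (E : RInt (f' d) 0 PI = / (d * rad K d) * slope K d).
{ unfold slope.
  rewrite <- (RInt_scal (V := R_CompleteNormedModule)).
  - apply RInt_ext. intros t _. pose proof (orbit_pos _ _ t Ho) as [Hw Hg].
    unfold f', slope_dens, scal, mult; simpl. unfold mult; simpl.
    transitivity ((d + coefB K d * cos t) / (rad K d * gap K d t) * dens K d t); trivial.
    (* An extra factor d turns the numerator d + [coefB] cos t into an affine function of [gap], so
       that only the integrals of [dens / gap] and [dens] remain. The identity rests on 3 [half_sum]
       - [rad] = 1. *)
    replace (half_sum K d * K - coefB K d * gap K d t) with (d * (d + coefB K d * cos t)).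
    + field. lra.
    + unfold coefB, half_sum, gap. apply Rminus_diag_uniq.
      transitivity ((1 + rad K d) / 3 * (rad K d ^ 2 - (K - 3 * d^2))); [field|].
      rewrite Hr2; ring.
  - apply ex_RInt_cts. intros t. apply (cts_angle (slope_dens K)).
    pose proof (orbit_pos _ _ t Ho) as [Hw Hg]. unfold slope_dens.
    cts; trivial; simpl; lra. }
rewrite E in D. apply (is_derive_scal _ _ 2) in D. evar_last. exact D.
unfold scal; simpl. unfold mult; simpl. field. lra.
Qed.

(* Gauss-Manin reduction: the left side is rad times the d-derivative of the integrand of [slope],
   divided by [dens], with x = cos t.  The last two lines of the right side are the t-derivative of
   sin t (e^2/(2S) + K^2/(2q) N/M) dens, divided by [dens]. *)
Lemma slope_dens_identity (s d x : R) :
  let r := 2 - 3 * s in let K := r^2 + 3 * d^2 in let p := 1 - s in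
  let N := s + d * x in let M := r - d * x in let B := d^2 + r * p in
  let S := s^2 - d^2 in let q := r^2 - d^2 in let c := 2 * p * S in
  let e := d^2 - r * s in
  r <> 0 -> K <> 0 -> p <> 0 -> N <> 0 -> M <> 0 -> S <> 0 -> q <> 0 ->
  (- d * K / M + p * K * (3 * d + r * x) / M^2 + d)
  - 1/2 * (p * K / M - B) * ((d + r * x) / N - (3 * d + r * x) / M)
  = d * ((q * (1 - K) / (3 * S) + 8 * p * r * K / q) / (p * K)) * (p * K / M - B)
  + d * ((1 + K) * c - 2/27 * (K - 1)^2 * (4 - K)) / (c * K)
  + x * (e^2 / (2 * S) + K^2 / (2 * q) * N / M)
  + (1 - x^2) * d * (1/2 * (e^2 / (2 * S) + K^2 / (2 * q) * N / M) * (/ N - / M)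
                 - K^2 / (2 * q) * (M + N) / M^2).
Proof.
intros r K p N M B S q c e Hr HK Hp HN HM HS Hq.
unfold c. unfold B, e.
field_simplify_eq; [|repeat split; assumption].
unfold K, q, S, N, M, p, r. ring.
Qed.

(** Arranged so that the bracket divided by [rad] is the left side of [slope_dens_identity]. *)
Definition dslope_dens (K d t : R) : R :=
  ((- d * K / gap K d t
    + half_sum K d * K * (3 * d + rad K d * cos t) / gap K d t ^ 2 + d)
   - 1/2 * (half_sum K d * K / gap K d t - coefB K d)
     * ((d + rad K d * cos t) / wave K d t - (3 * d + rad K d * cos t) / gap K d t))
  / rad K d * dens K d t.

Lemma is_derive_half_sum K d : orbit K d -> is_derive (half_sum K) d (- d / rad K d).
Proof.
intros Ho. pose proof (is_derive_rad _ _ Ho) as Hd. apply orbit_rad in Ho. unfold half_sum.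
auto_derive.
- eexists; exact Hd.
- replace (Derive (fun x => rad K x) d) with (-3 * d / rad K d)
    by (symmetry; now apply is_derive_unique). field. lra.
Qed.

Lemma is_derive_coefB K d : orbit K d -> is_derive (coefB K) d (- d / rad K d).
Proof.
intros Ho. pose proof (is_derive_rad _ _ Ho) as Hd. pose proof (is_derive_half_sum _ _ Ho) as Hh.
apply orbit_rad in Ho. unfold coefB.
auto_derive.
- repeat split; eexists; eassumption.
- replace (Derive (fun x => rad K x) d) with (-3 * d / rad K d)
    by (symmetry; now apply is_derive_unique).
  replace (Derive (fun x => half_sum K x) d) with (- d / rad K d)
    by (symmetry; now apply is_derive_unique). unfold half_sum. field. lra.
Qed.

Lemma is_derive_slope_dens K d t : orbit K d ->
  is_derive (fun u => slope_dens K u t) d (dslope_dens K d t).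
Proof.
intros Ho.
pose proof (is_derive_half_sum _ _ Ho) as Dh. pose proof (is_derive_coefB _ _ Ho) as DB.
pose proof (is_derive_gap _ _ t Ho) as Dg. pose proof (is_derive_dens _ _ t Ho) as Dn.
pose proof (orbit_rad _ _ Ho) as [Hr _]. pose proof (orbit_pos _ _ t Ho) as [Hw Hg].
unfold slope_dens.
pose (gp := fun u => gap K u t). pose (dn := fun u => dens K u t).
match type of Dn with is_derive _ _ ?v => pose (dn' := v); change v with dn' in Dn end.
change (is_derive (fun u => (half_sum K u * K - coefB K u * gp u) / gp u * dn u) d (dslope_dens K d t)).
auto_derive.
- repeat split; try (eexists; eassumption). unfold gp; lra.
- replace (Derive (fun x => half_sum K x) d) with (- d / rad K d)
    by (symmetry; now apply is_derive_unique).
  replace (Derive (fun x => coefB K x) d) with (- d / rad K d)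
    by (symmetry; now apply is_derive_unique).
  replace (Derive (fun x => gp x) d) with (- (3 * d / rad K d + cos t))
    by (symmetry; now apply is_derive_unique).
  replace (Derive (fun x => dn x) d) with dn' by (symmetry; now apply is_derive_unique).
  unfold gp, dn, dn', dslope_dens. field. lra.
Qed.

Lemma cts_slope_dens K d t : orbit K d -> continuous (slope_dens K d) t.
Proof.
intros Ho. apply (cts_angle (slope_dens K)).
pose proof (orbit_pos _ _ t Ho) as [Hw Hg]. unfold slope_dens.
cts; trivial; simpl; lra.
Qed.

Lemma cts_dens_angle K d t : orbit K d -> continuous (dens K d) t.
Proof. intros Ho. apply (cts_angle (dens K)). now cts. Qed.

(** [H1] is a primitive of [h], and its factor sin t vanishes at both ends. The coefficients a and b
    are free, to be fitted to the poles in [is_derive_slope]. *)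
Lemma is_RInt_boundary_term K d a b : orbit K d ->
  let H1 := fun t => sin t * ((a + b * (wave K d t / gap K d t)) * dens K d t) in
  let h := fun t => (cos t * (a + b * wave K d t / gap K d t)
    + (1 - cos t ^ 2) * d * (1/2 * (a + b * wave K d t / gap K d t)
        * (1 / wave K d t - 1 / gap K d t)
      - b * (gap K d t + wave K d t) / gap K d t ^ 2)) * dens K d t in
  is_RInt h 0 PI 0.
Proof.
intros Ho H1 h.
evar_last.
{ apply (is_RInt_derive H1 h).
  - intros t _. pose proof (orbit_pos _ _ t Ho) as [Hw Hg].
    pose proof (is_derive_dens_angle _ _ t Ho) as Dn.
    assert (D1 : is_derive (wave K d) t (- d * sin t)).
    { unfold wave. auto_derive; trivial. ring. }
    assert (D2 : is_derive (gap K d) t (d * sin t)).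
    { unfold gap. auto_derive; trivial. ring. }
    match type of Dn with is_derive _ _ ?v => pose (dn' := v); change v with dn' in Dn end.
    unfold H1. auto_derive.
    + repeat split; try (eexists; eassumption). lra.
    + replace (Derive (fun x => wave K d x) t) with (- d * sin t)
        by (symmetry; now apply is_derive_unique).
      replace (Derive (fun x => gap K d x) t) with (d * sin t)
        by (symmetry; now apply is_derive_unique).
      replace (Derive (fun x => dens K d x) t) with dn'
        by (symmetry; now apply is_derive_unique). unfold dn'.
      unfold h. replace (1 - cos t ^ 2) with (sin t * sin t)
        by (pose proof (sin2_cos2 t) as E; unfold Rsqr in E; lra).
      field. lra.
  - intros t _. pose proof (orbit_pos _ _ t Ho) as [Hw Hg]. unfold h.
    apply (cts_angle (fun d t => (cos t * (a + b * wave K d t / gap K d t)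
    + (1 - cos t ^ 2) * d * (1/2 * (a + b * wave K d t / gap K d t)
        * (1 / wave K d t - 1 / gap K d t)
      - b * (gap K d t + wave K d t) / gap K d t ^ 2)) * dens K d t)).
    cts; trivial; simpl; nra. }
unfold H1. rewrite sin_PI, sin_0. unfold minus, plus, opp; simpl. ring.
Qed.

Lemma is_derive_slope K d : orbit K d ->
  is_derive (slope K) d
    (d / rad K d *
      (((K - 4 * d^2) * (1 - K) / (3 * (mid K d ^ 2 - d^2))
        + 8 * half_sum K d * rad K d * K / (K - 4 * d^2)) / (half_sum K d * K) * slope K d
       + excess K (flux K d) / (flux K d * K) * dens_int K d)).
Proof.
intros Ho. pose proof (orbit_open _ _ Ho) as Hl.
pose proof (orbit_rad _ _ Ho) as [Hr Hr2]. pose proof (orbit_bounds _ _ Ho) as [Hb1 Hb2].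
evar_last.
{ apply (is_derive_under_RInt (slope_dens K) (dslope_dens K)).
  - eapply filter_imp; [|exact Hl]. intros y Hy t. now apply is_derive_slope_dens.
  - eapply filter_imp; [|exact Hl]. intros y Hy t. now apply cts_slope_dens.
  - intros t. pose proof (orbit_pos _ _ t Ho) as [Hw Hg]. unfold dslope_dens.
    cts; trivial; simpl; nra. }
set (S := mid K d ^ 2 - d^2). set (q := K - 4 * d^2). set (e := d^2 - rad K d * mid K d).
assert (HS : 0 < S) by (unfold S; nra).
assert (Hq : 0 < q) by (unfold q; nra).
assert (HK : 0 < K) by nra.
assert (Hp : 0 < half_sum K d) by (unfold half_sum; lra).
set (lam := (q * (1 - K) / (3 * S) + 8 * half_sum K d * rad K d * K / q) / (half_sum K d * K)).
set (y := excess K (flux K d) / (flux K d * K)).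
(* The two coefficients are found by matching poles in x = cos t (for d <> 0). Where [wave]
   vanishes, d + [rad] x equals e/d, which gives e^2/(2S) from the simple pole; where [gap]
   vanishes, 3d + [rad] x equals K/d, which gives K^2/(2q) from the double pole. *)
pose proof (is_RInt_boundary_term K d (e^2 / (2 * S)) (K^2 / (2 * q)) Ho) as Hb.
cbv zeta in Hb.
assert (IG : is_RInt (slope_dens K d) 0 PI (slope K d)).
{ apply (RInt_correct (V := R_CompleteNormedModule)), ex_RInt_cts.
  intros t; now apply cts_slope_dens. }
assert (IJ : is_RInt (dens K d) 0 PI (dens_int K d)).
{ apply (RInt_correct (V := R_CompleteNormedModule)), ex_RInt_cts.
  intros t; now apply cts_dens_angle. }
apply is_RInt_unique.
pose proof (is_RInt_plus _ _ _ _ _ _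
  (is_RInt_scal _ _ _ (d / rad K d) _
    (is_RInt_plus _ _ _ _ _ _ (is_RInt_scal _ _ _ lam _ IG) (is_RInt_scal _ _ _ y _ IJ)))
  (is_RInt_scal _ _ _ (/ rad K d) _ Hb)) as HI.
evar_last; [eapply is_RInt_ext; [|exact HI]|].
- intros t _. unfold plus, scal; simpl; unfold mult; simpl.
  pose proof (orbit_pos _ _ t Ho) as [Hw Hg].
  pose proof (slope_dens_identity (mid K d) d (cos t)) as I. cbv zeta in I.
  replace (2 - 3 * mid K d) with (rad K d) in I by (unfold mid; field).
  replace (1 - mid K d) with (half_sum K d) in I by (unfold mid, half_sum; field).
  replace (rad K d ^ 2 + 3 * d^2) with K in I by lra.
  replace (rad K d ^ 2 - d^2) with q in I by (unfold q; lra).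
  fold (coefB K d) (wave K d t) (gap K d t) S e in I.
  specialize (I ltac:(lra) ltac:(lra) ltac:(lra) ltac:(lra) ltac:(lra) ltac:(lra) ltac:(lra)).
  unfold dslope_dens. rewrite I. unfold y, excess, flux, slope_dens. fold S lam.
  field. repeat split; lra.
- unfold plus, scal; simpl; unfold mult; simpl. unfold y. ring.
Qed.

(** * Mean value criteria and the shape of a level *)

Lemma is_derive_lt (f f' : R -> R) a b : a < b ->
  (forall x, a <= x <= b -> is_derive f x (f' x)) ->
  (forall x, a < x < b -> 0 < f' x) -> f a < f b.
Proof.
intros Hab Hd Hp.
destruct (MVT_cor2 f f' a b Hab) as [x [Hx1 Hx2]].
{ intros x Hx. apply is_derive_Reals. now apply Hd. }
specialize (Hp x Hx2). nra.
Qed.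

Lemma is_derive_ge (f f' : R -> R) a b : a <= b ->
  (forall x, a <= x <= b -> is_derive f x (f' x)) ->
  (forall x, a <= x <= b -> f' x <= 0) -> f b <= f a.
Proof.
intros [Hab|<-] Hd Hp; [|lra].
destruct (MVT_cor2 f f' a b Hab) as [x [Hx1 Hx2]].
{ intros x Hx. apply is_derive_Reals. now apply Hd. }
specialize (Hp x (conj (Rlt_le _ _ (proj1 Hx2)) (Rlt_le _ _ (proj2 Hx2)))). nra.
Qed.

Lemma is_derive_gt (f f' : R -> R) a b : a < b ->
  (forall x, a <= x <= b -> is_derive f x (f' x)) ->
  (forall x, a < x < b -> f' x < 0) -> f b < f a.
Proof.
intros Hab Hd Hp.
destruct (MVT_cor2 f f' a b Hab) as [x [Hx1 Hx2]].
{ intros x Hx. apply is_derive_Reals. now apply Hd. }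
specialize (Hp x Hx2). nra.
Qed.

Lemma orbit_facts K d : orbit K d ->
  0 < rad K d < 2 /\ 0 < half_sum K d < 1 /\ 0 < K - 4 * d^2 /\ 0 < flux K d /\ 0 < K.
Proof.
intros Ho. pose proof (orbit_rad _ _ Ho) as [Hr Hr2]. pose proof (orbit_bounds _ _ Ho) as [Hb1 Hb2].
unfold flux, half_sum. assert (rad K d < 2) by (unfold mid in Hb2; lra).
repeat split; try lra; try nra.
apply Rmult_lt_0_compat; nra.
Qed.

(** Shrinking the half-width separates the roots: [rad] grows, while rad^2 + 3 d^2 = K and d < [rad]
    bound its growth by 3 (b - a), so that [mid - d] grows too. The weak inequality at b lets the
    peaked end [b = mid K b] serve as the upper end. *)
Lemma orbit_interval K a b : 0 <= a < b -> b < rad K b -> b <= mid K b -> orbit K a.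
Proof.
intros Hab Hb1 Hb2.
assert (Hb : rad K b ^ 2 = K - 3 * b^2).
{ unfold rad in *. apply pow2_sqrt.
  destruct (Rle_lt_dec 0 (K - 3*b^2)); trivial. rewrite sqrt_neg_0 in Hb1; lra. }
assert (Ha : rad K a ^ 2 = K - 3 * a^2) by (unfold rad; apply pow2_sqrt; nra).
assert (H0 : 0 <= rad K a) by apply sqrt_pos.
assert (Hm : rad K b <= rad K a) by (apply sqrt_le_1_alt; nra).
assert (Hd : rad K a - rad K b < 3 * (b - a)) by nra.
unfold orbit. rewrite Rabs_pos_eq by lra. unfold mid in *. lra.
Qed.

Lemma orbit_le K a b : orbit K b -> 0 <= a <= b -> orbit K a.
Proof.
intros Hb [H0 [H1| ->]]; trivial. apply orbit_bounds in Hb.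
apply (orbit_interval K a b); lra.
Qed.

Lemma orbit_lt4 K d : orbit K d -> 0 <= d -> K < 4.
Proof.
intros Ho Hd. pose proof (orbit_rad _ _ Ho) as [Hr Hr2]. apply orbit_bounds in Ho.
unfold mid in Ho. nra.
Qed.

Lemma flux_rad K d : orbit K d ->
  flux K d = 2/27 * (4 * rad K d ^ 3 - 3 * K * rad K d + 4 - 3 * K).
Proof.
intros Ho. apply orbit_rad in Ho. destruct Ho as [Hr Hr2]. unfold flux, half_sum, mid.
replace (d^2) with ((K - rad K d ^ 2)/3) by lra. field.
Qed.

Lemma is_derive_flux K d : orbit K d ->
  is_derive (flux K) d (-2 * (K - 4 * d^2) * d / rad K d).
Proof.
intros Ho. pose proof (is_derive_half_sum _ _ Ho) as Dh. pose proof (is_derive_mid _ _ Ho) as Dm.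
apply orbit_rad in Ho. destruct Ho as [Hr Hr2].
unfold flux. auto_derive.
- repeat split; eexists; eassumption.
- replace (Derive (fun x => half_sum K x) d) with (- d / rad K d)
    by (symmetry; now apply is_derive_unique).
  replace (Derive (fun x => mid K x) d) with (d / rad K d)
    by (symmetry; now apply is_derive_unique).
  replace K with (rad K d ^ 2 + 3 * d^2) at 7 by lra.
  unfold half_sum, mid. field. lra.
Qed.

Lemma flux_decr K a b : orbit K b -> 0 <= a < b -> flux K b < flux K a.
Proof.
intros Hb Hab. apply (is_derive_gt (flux K) (fun d => -2 * (K - 4 * d^2) * d / rad K d)).
- lra.
- intros x Hx. apply is_derive_flux. apply (orbit_le K x b Hb). lra.
- intros x Hx. assert (Ho : orbit K x) by (apply (orbit_le K x b Hb); lra).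
  apply orbit_facts in Ho. apply Rdiv_neg_pos; nra.
Qed.

(* The factor in front of [slope] is the integrating factor of [is_derive_slope]. *)
Definition wslope (K d : R) : R :=
  (K - 4 * d^2) * Rpower (flux K d) ((1 - K) / (3 * K)) * slope K d.

(** * The weighted slope and its monotonicity *)

Lemma is_derive_Rpower_flux K rho d : orbit K d ->
  is_derive (fun u => Rpower (flux K u) rho) d
   (Rpower (flux K d) rho * (rho * (-2 * (K - 4 * d^2) * d / rad K d) / flux K d)).
Proof.
intros Ho. pose proof (is_derive_flux _ _ Ho) as D. pose proof (orbit_facts _ _ Ho) as F.
match type of D with is_derive _ _ ?v => pose (v' := v); change v with v' in D; fold v' end.
unfold Rpower. auto_derive.
- split; [eexists; eassumption|]. lra.
- replace (Derive (fun x => flux K x) d) with v' by (symmetry; now apply is_derive_unique).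
  field. lra.
Qed.

(** The coefficient of [slope] in [is_derive_slope] has two terms. One is cancelled by the
    logarithmic derivative -8 d / (K - 4 d^2) of the first weight, the other by that of the power of
    [flux], since [flux] has derivative -2 (K - 4 d^2) d / [rad]. *)
Lemma is_derive_wslope K d : orbit K d ->
  is_derive (wslope K) d
    ((K - 4 * d^2) * Rpower (flux K d) ((1 - K) / (3 * K)) * (d / rad K d)
      * (excess K (flux K d) / (flux K d * K) * dens_int K d)).
Proof.
intros Ho. pose proof (is_derive_Rpower_flux K ((1 - K) / (3 * K)) d Ho) as D1.
pose proof (is_derive_slope _ _ Ho) as D2. pose proof (orbit_facts _ _ Ho) as F.
pose proof (orbit_bounds _ _ Ho) as Hb.
assert (S0 : 0 < mid K d ^ 2 - d ^ 2) by nra.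
unfold wslope.
match type of D1 with is_derive _ _ ?v => pose (v1 := v); change v with v1 in D1 end.
match type of D2 with is_derive _ _ ?v => pose (v2 := v); change v with v2 in D2 end.
pose (P := fun u => Rpower (flux K u) ((1 - K) / (3 * K))).
change (is_derive P d v1) in D1.
change (is_derive (fun u => (K - 4 * u^2) * P u * slope K u) d
 ((K - 4 * d^2) * P d * (d / rad K d)
      * (excess K (flux K d) / (flux K d * K) * dens_int K d))).
auto_derive.
- repeat split; eexists; eassumption.
- replace (Derive (fun x => P x) d) with v1 by (symmetry; now apply is_derive_unique).
  replace (Derive (fun x => slope K x) d) with v2 by (symmetry; now apply is_derive_unique).
  unfold v1, v2. fold (P d). generalize (excess K (flux K d)); intros e.
  set (S := mid K d ^ 2 - d ^2) in *.
  clearbody P. unfold flux; fold S.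
  match goal with |- @eq _ ?x ?y => change (@eq R x y) end. field. repeat split; lra.
Qed.

(** At d = 0 the integrand itself vanishes: [gap] is [rad], [coefB] is [rad * half_sum], and K is
    rad^2. *)
Lemma wslope_0 K : orbit K 0 -> wslope K 0 = 0.
Proof.
intros Ho. unfold wslope. replace (slope K 0) with 0; [ring|]. symmetry.
apply is_RInt_unique. apply (is_RInt_ext (fun _ => 0)).
- intros t _. pose proof (orbit_pos _ _ t Ho) as [_ Hg].
  apply orbit_rad in Ho. destruct Ho as [Hr Hr2]. unfold slope_dens.
  replace (half_sum K 0 * K - coefB K 0 * gap K 0 t) with 0; [unfold Rdiv; now rewrite !Rmult_0_l|].
  unfold coefB, gap. replace K with (rad K 0 ^ 2) at 2 by lra. ring.
- evar_last. apply (is_RInt_const (V := R_NormedModule)). unfold scal; simpl; unfold mult; simpl; ring.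
Qed.

(** By the inequality of the means, [wave + gap] < 2 forces [wave * gap] < 1, so [dens] exceeds 1 on
    an interval of length PI. Besides positivity, this gives the uniform lower bound used in
    [wslope_takes_neg]. *)
Lemma dens_int_ge_1 K d : orbit K d -> 1 <= dens_int K d.
Proof.
intros Ho. apply Rle_trans with (RInt (fun _ => 1) 0 PI).
- rewrite RInt_const. unfold scal; simpl; unfold mult; simpl.
  pose proof PI2_1. lra.
- apply RInt_le.
  + pose proof PI_RGT_0. lra.
  + apply ex_RInt_const.
  + apply ex_RInt_cts. intros t; now apply cts_dens_angle.
  + intros t _. pose proof (orbit_pos _ _ t Ho) as [Hw Hg].
    pose proof (orbit_facts _ _ Ho) as F. unfold dens.
    assert (H : wave K d t + gap K d t < 2) by (unfold wave, gap, mid; lra).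
    assert (Hp : 0 < wave K d t * gap K d t) by nra.
    rewrite <- Rinv_1. apply Rinv_le_contravar. now apply sqrt_lt_R0.
    rewrite <- sqrt_1. apply sqrt_le_1_alt.
    assert (0 <= (wave K d t - gap K d t)^2) by apply pow2_ge_0. nra.
Qed.

Lemma slope_pos_iff K d : orbit K d -> (0 < wslope K d <-> 0 < slope K d).
Proof.
intros Ho. pose proof (orbit_facts _ _ Ho) as F. unfold wslope.
assert (H : 0 < (K - 4 * d^2) * Rpower (flux K d) ((1 - K) / (3 * K)))
  by (apply Rmult_lt_0_compat; [lra|apply exp_pos]).
split; intros; nra.
Qed.

Lemma slope_neg_iff K d : orbit K d -> (wslope K d < 0 <-> slope K d < 0).
Proof.
intros Ho. pose proof (orbit_facts _ _ Ho) as F. unfold wslope.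
assert (H : 0 < (K - 4 * d^2) * Rpower (flux K d) ((1 - K) / (3 * K)))
  by (apply Rmult_lt_0_compat; [lra|apply exp_pos]).
split; intros; nra.
Qed.

Lemma wslope_incr K a b : orbit K b -> 0 <= a < b ->
  (forall x, a < x < b -> 0 < excess K (flux K x)) -> wslope K a < wslope K b.
Proof.
intros Hb Hab He. eapply is_derive_lt; [lra| |].
- intros x Hx. apply is_derive_wslope. apply (orbit_le K x b Hb). lra.
- intros x Hx. assert (Ho : orbit K x) by (apply (orbit_le K x b Hb); lra).
  simpl. pose proof (orbit_facts _ _ Ho) as F. pose proof (dens_int_ge_1 _ _ Ho).
  specialize (He x Hx).
  repeat apply Rmult_lt_0_compat; try lra; try apply exp_pos;
    try (apply Rinv_0_lt_compat; nra).
Qed.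

Lemma wslope_decr K a b : orbit K b -> 0 <= a < b ->
  (forall x, a < x < b -> excess K (flux K x) < 0) -> wslope K b < wslope K a.
Proof.
intros Hb Hab He. eapply is_derive_gt; [lra| |].
- intros x Hx. apply is_derive_wslope. apply (orbit_le K x b Hb). lra.
- intros x Hx. assert (Ho : orbit K x) by (apply (orbit_le K x b Hb); lra).
  simpl. pose proof (orbit_facts _ _ Ho) as F. pose proof (dens_int_ge_1 _ _ Ho).
  specialize (He x Hx).
  set (rho := (1 - K) / (3 * K)).
  assert (Hu : 0 < (K - 4 * x^2) * Rpower (flux K x) rho * (x / rad K x)
                   * (/ (flux K x * K) * dens_int K x)).
  { repeat apply Rmult_lt_0_compat; try lra; try apply exp_pos;
    try (apply Rinv_0_lt_compat; nra). }
  unfold Rdiv in *. nra.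
Qed.

Lemma scaled_period_incr K a b : orbit K b -> 0 < a < b ->
  (forall x, a < x < b -> 0 < slope K x) -> scaled_period K a < scaled_period K b.
Proof.
intros Hb Hab HG. eapply is_derive_lt; [lra| |].
- intros x Hx. apply is_derive_scaled_period; [|lra]. apply (orbit_le K x b Hb). lra.
- intros x Hx. assert (Ho : orbit K x) by (apply (orbit_le K x b Hb); lra).
  simpl. pose proof (orbit_facts _ _ Ho) as F. specialize (HG x Hx).
  apply Rmult_lt_0_compat; trivial. apply Rdiv_lt_0_compat; nra.
Qed.

Lemma scaled_period_decr K a b : orbit K b -> 0 < a < b ->
  (forall x, a < x < b -> slope K x < 0) -> scaled_period K b < scaled_period K a.
Proof.
intros Hb Hab HG. eapply is_derive_gt; [lra| |].
- intros x Hx. apply is_derive_scaled_period; [|lra]. apply (orbit_le K x b Hb). lra.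
- intros x Hx. assert (Ho : orbit K x) by (apply (orbit_le K x b Hb); lra).
  simpl. pose proof (orbit_facts _ _ Ho) as F. specialize (HG x Hx).
  assert (0 < 2 / (x * rad K x)) by (apply Rdiv_lt_0_compat; nra). nra.
Qed.

(** * Sign of the excess on a level *)

Lemma sqrt_K K : 0 < K -> 0 < sqrt K /\ sqrt K ^ 2 = K.
Proof. intros H. split; [now apply sqrt_lt_R0|]. apply pow2_sqrt. lra. Qed.

(** The excess increases with [flux], so it suffices to bound [flux] below by its value at the
    solitary end [rad] = k/2, with k = sqrt K. The bound is 4 r^3 - 3 k^2 r + k^3 = (r + k) (2r -
    k)^2 >= 0, and the excess of the limiting value contains the factor 1 - k. *)
Lemma excess_pos K d : orbit K d -> K < 1 -> 0 < excess K (flux K d).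
Proof.
intros Ho HK. pose proof (orbit_facts _ _ Ho) as F. rewrite flux_rad by trivial.
pose proof (orbit_rad _ _ Ho) as [Hr Hr2].
destruct (sqrt_K K) as [Hk Hk2]; [lra|]. set (k := sqrt K) in *. set (r := rad K d) in *.
assert (Hk1 : k < 1) by nra.
assert (H : - k^3 <= 4 * r^3 - 3 * K * r).
{ rewrite <- Hk2. assert (0 <= (r + k) * (2 * r - k)^2) by (apply Rmult_le_pos; [lra|apply pow2_ge_0]). nra. }
unfold excess.
apply Rlt_le_trans with ((1 + K) * (2/27 * (- k^3 + 4 - 3 * K)) - 2/27 * (K - 1)^2 * (4 - K)); [|nra].
rewrite <- Hk2.
replace (_ - _) with (2/27 * ((1 - k) * (2 + k) * (k^2 * (5 + 2 * k - k^2)))) by ring.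
repeat apply Rmult_lt_0_compat; try lra.
Qed.

Lemma flux_0 K : orbit K 0 -> flux K 0 = 2/27 * (sqrt K ^ 3 + 4 - 3 * sqrt K ^ 2).
Proof.
intros Ho. pose proof (orbit_facts _ _ Ho) as F. rewrite flux_rad by trivial.
replace (rad K 0) with (sqrt K) by (unfold rad; f_equal; ring).
destruct (sqrt_K K) as [Hk Hk2]; [lra|]. replace K with (sqrt K ^ 2) at 2 4 by trivial. ring.
Qed.

(** The last factor is the origin of [b_1]; the others are positive by [excess_0_factor]. *)
Lemma excess_0 K : orbit K 0 ->
  excess K (flux K 0) = 2/27 * ((sqrt K + 1) * (2 - sqrt K) * sqrt K ^ 2)
                        * (5 - 2 * sqrt K - K).
Proof.
intros Ho. pose proof (orbit_facts _ _ Ho) as F. rewrite flux_0 by trivial.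
destruct (sqrt_K K) as [Hk Hk2]; [lra|]. unfold excess.
set (k := sqrt K) in *. rewrite <- Hk2. ring.
Qed.

Lemma excess_0_factor K : orbit K 0 -> 0 < (sqrt K + 1) * (2 - sqrt K) * sqrt K ^ 2.
Proof.
intros Ho. pose proof (orbit_facts _ _ Ho) as F. pose proof (orbit_lt4 _ _ Ho (Rle_refl _)).
destruct (sqrt_K K) as [Hk Hk2]; [lra|].
repeat apply Rmult_lt_0_compat; try lra; nra.
Qed.

Lemma excess_neg K d : orbit K d -> 0 <= d -> 5 < K + 2 * sqrt K -> excess K (flux K d) < 0.
Proof.
intros Ho Hd HK.
assert (Ho0 : orbit K 0) by (apply (orbit_le K 0 d Ho); lra).
assert (H : flux K d <= flux K 0).
{ destruct Hd as [Hd|<-]; [|lra]. apply Rlt_le, flux_decr; trivial. lra. }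
pose proof (orbit_facts _ _ Ho) as F.
apply Rle_lt_trans with (excess K (flux K 0)); [unfold excess; nra|].
rewrite excess_0 by trivial. pose proof (excess_0_factor K Ho0). nra.
Qed.

(** * Monotone and unimodal levels *)

Lemma scaled_period_incr_small_K K a b : K < 1 -> orbit K b -> 0 < a < b -> scaled_period K a < scaled_period K b.
Proof.
intros HK Hb Hab. apply scaled_period_incr; trivial. intros x Hx.
assert (Ho : orbit K x) by (apply (orbit_le K x b Hb); lra).
apply slope_pos_iff; trivial. rewrite <- (wslope_0 K) by (apply (orbit_le K 0 b Hb); lra).
apply wslope_incr; trivial; [lra|]. intros y Hy. apply excess_pos; trivial.
apply (orbit_le K y b Hb); lra.
Qed.

Lemma scaled_period_decr_large_K K a b : 5 < K + 2 * sqrt K -> orbit K b -> 0 < a < b ->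
  scaled_period K b < scaled_period K a.
Proof.
intros HK Hb Hab. apply scaled_period_decr; trivial. intros x Hx.
assert (Ho : orbit K x) by (apply (orbit_le K x b Hb); lra).
apply slope_neg_iff; trivial. rewrite <- (wslope_0 K) by (apply (orbit_le K 0 b Hb); lra).
apply wslope_decr; trivial; [lra|]. intros y Hy. apply excess_neg; trivial; [|lra].
apply (orbit_le K y b Hb); lra.
Qed.

Lemma flux_surj K c : 1 < K -> orbit K 0 -> 0 < c < flux K 0 ->
  exists d, 0 < d /\ orbit K d /\ flux K d = c.
Proof.
intros HK Ho Hc. pose proof (orbit_lt4 _ _ Ho (Rle_refl _)) as HK4.
(* The peaked end b solves [mid] = b, so [rad] = 2 - 3b and (2 - 3b)^2 + 3 b^2 = K; the smaller root
   is (1 - w)/2. There [flux] is 0. *)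
set (w := sqrt ((K - 1) / 3)).
assert (Hw2 : w ^ 2 = (K - 1) / 3) by (apply pow2_sqrt; lra).
assert (Hw0 : 0 <= w) by apply sqrt_pos.
set (b := (1 - w) / 2).
assert (Hb : 0 < b) by (unfold b; nra).
assert (Hr : rad K b = 2 - 3 * b).
{ unfold rad. replace (K - 3 * b^2) with ((2 - 3 * b)^2) by (unfold b; nra).
  apply sqrt_pow2. unfold b; lra. }
assert (Hm : mid K b = b) by (unfold mid; rewrite Hr; field).
(* Continuity is shown at every real x, because the end b itself is not an [orbit]. *)
assert (Hcont : forall x, continuity_pt (fun x => c - flux K x) x).
{ intros x. apply continuity_pt_filterlim.
  assert (Hrad : continuous (rad K) x).
  { apply (cts_sqrt (fun d => K - 3 * d^2)).
    apply (ex_derive_continuous (fun d => K - 3 * d^2)). now auto_derive. }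
  apply (cts_minus (fun _ => c) (flux K)); [apply continuous_const|].
  unfold flux, half_sum, mid.
  apply (cts_mult (fun x => 2 * ((1 + rad K x)/3)) (fun x => ((2 - rad K x)/3)^2 - x^2)).
  - apply (cts_mult (fun _ => 2) (fun x => (1 + rad K x)/3)); [apply continuous_const|].
    apply (cts_div (fun x => 1 + rad K x) (fun _ => 3)); try apply continuous_const; try lra.
    apply (cts_plus (fun _ => 1) (rad K)); trivial; apply continuous_const.
  - apply (cts_minus (fun x => ((2 - rad K x)/3)^2) (fun x => x^2));
      [apply (cts_pow (fun x => (2 - rad K x)/3))|apply (cts_pow (fun x => x)), continuous_id].
    apply (cts_div (fun x => 2 - rad K x) (fun _ => 3)); try apply continuous_const; try lra.
    apply (cts_minus (fun _ => 2) (rad K)); trivial; apply continuous_const. }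
destruct (IVT_interv (fun x => c - flux K x) 0 b) as [d [Hd1 Hd2]]; trivial.
- lra.
- unfold flux. rewrite Hm. lra.
- simpl in Hd2.
  assert (d <> 0) by (intros ->; lra).
  assert (d <> b) by (intros ->; unfold flux in Hd2; rewrite Hm in Hd2; lra).
  exists d. split; [lra|]. split; [|lra].
  apply (orbit_interval K d b); try lra. rewrite Hr. unfold b; nra.
Qed.

Lemma continuity_pt_wslope K d : orbit K d -> continuity_pt (wslope K) d.
Proof.
intros Ho. apply derivable_continuous_pt.
exists (Derive (wslope K) d). apply is_derive_Reals, Derive_correct.
eexists. now apply is_derive_wslope.
Qed.

(* Where the excess is at most -y < 0, wslope plus a small multiple of
   flux^rho is nonincreasing in d, and rho < 0 makes flux^rho unbounded at the peaked end. *)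
Lemma wslope_takes_neg K : 1 < K -> orbit K 0 -> exists d, 0 < d /\ orbit K d /\ wslope K d < 0.
Proof.
intros HK Ho. pose proof (orbit_lt4 _ _ Ho (Rle_refl _)) as HK4.
set (cst := 2/27 * (K - 1)^2 * (4 - K) / (1 + K)).
pose proof (orbit_facts _ _ Ho) as F0.
assert (Hcst : 0 < cst).
{ apply Rdiv_lt_0_compat; [|lra]. repeat apply Rmult_lt_0_compat; lra. }
assert (Hex : forall c, excess K c = (1 + K) * (c - cst)).
{ intros c. unfold excess, cst. field. lra. }
(* Below cst / 2 the excess is at most -y; below flux K 0 the value is attained on the level. *)
set (c1 := Rmin (cst / 2) (flux K 0 / 2)).
assert (Hc1 : 0 < c1 <= cst / 2 /\ c1 <= flux K 0 / 2).
{ unfold c1. pose proof (Rmin_l (cst / 2) (flux K 0 / 2)). pose proof (Rmin_r (cst / 2) (flux K 0 / 2)).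
  repeat split; trivial. apply Rmin_glb_lt; lra. }
destruct (flux_surj K c1) as [d1 [Hd1 [Ho1 Hf1]]]; trivial; [lra|].
set (rho := (1 - K) / (3 * K)).
assert (Hrho : rho < 0) by (apply Rdiv_neg_pos; lra).
set (y := (1 + K) * cst / 2).
assert (Hy : 0 < y) by (unfold y; nra).
(* With this A the derivative of A flux^rho is y/K times the common positive factor, just offset by
   the excess term, which is at most -y/K because [dens_int] >= 1. *)
set (A := y / (2 * K * - rho)).
assert (HA : 0 < A) by (apply Rdiv_lt_0_compat; nra).
(* Once flux^rho has risen to X, the added term has grown by |wslope K d1| + 1, so [wslope] must
   have fallen to -1 or below. *)
set (X := Rpower c1 rho + (Rabs (wslope K d1) + 1) / A).
assert (HX : Rpower c1 rho < X).
{ unfold X. assert (0 < (Rabs (wslope K d1) + 1) / A); [|lra].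
  apply Rdiv_lt_0_compat; trivial. pose proof (Rabs_pos (wslope K d1)); lra. }
assert (HX0 : 0 < X) by (apply Rlt_trans with (2 := HX), exp_pos).
set (c2 := Rpower X (/ rho)).
assert (Hc2 : Rpower c2 rho = X).
{ unfold c2. rewrite Rpower_mult. replace (/ rho * rho) with 1 by (field; lra). now apply Rpower_1. }
assert (Hc20 : 0 < c2) by apply exp_pos.
assert (Hc21 : c2 < c1).
{ destruct (Rlt_le_dec c2 c1) as [|H]; trivial. exfalso.
  assert (Rpower c2 rho <= Rpower c1 rho); [|lra].
  replace rho with (- - rho) by ring. rewrite (Rpower_Ropp c2), (Rpower_Ropp c1).
  apply Rinv_le_contravar; [apply exp_pos|]. apply Rle_Rpower_l; lra. }
destruct (flux_surj K c2) as [d2 [Hd2 [Ho2 Hf2]]]; trivial; [lra|].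
assert (H12 : d1 <= d2).
{ destruct (Rle_lt_dec d1 d2) as [|H]; trivial. exfalso.
  pose proof (flux_decr K d2 d1 Ho1 ltac:(lra)). lra. }
exists d2. split; [trivial|split; [trivial|]].
assert (HV : wslope K d2 + A * Rpower (flux K d2) rho <= wslope K d1 + A * Rpower (flux K d1) rho).
{ eapply (is_derive_ge (fun d => wslope K d + A * Rpower (flux K d) rho)); [exact H12| |].
  - intros x Hx. assert (Hox : orbit K x) by (apply (orbit_le K x d2 Ho2); lra).
    apply (is_derive_plus (wslope K)). now apply is_derive_wslope.
    apply (is_derive_scal (fun d => Rpower (flux K d) rho)). now apply is_derive_Rpower_flux.
  - intros x Hx. assert (Hox : orbit K x) by (apply (orbit_le K x d2 Ho2); lra).
    pose proof (orbit_facts _ _ Hox) as F. pose proof (dens_int_ge_1 _ _ Hox) as HJ.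
    assert (Hfx : flux K x <= c1).
    { rewrite <- Hf1. destruct (Req_dec d1 x) as [->|]; [lra|].
      apply Rlt_le, flux_decr; trivial; lra. }
    unfold plus, scal; simpl; unfold mult; simpl. fold rho.
    rewrite Hex. set (P := Rpower (flux K x) rho).
    assert (HP : 0 < P) by apply exp_pos.
    replace (_ + _) with (((K - 4 * x^2) * P * (x / rad K x) / (flux K x))
      * ((1 + K) * (flux K x - cst) * dens_int K x / K + 2 * A * - rho)) by (field; lra).
    replace (2 * A * - rho) with (y / K) by (unfold A; field; lra).
    assert (0 < (K - 4 * x^2) * P * (x / rad K x) / (flux K x)).
    { repeat apply Rmult_lt_0_compat; try lra; apply Rinv_0_lt_compat; lra. }
    assert ((1 + K) * (flux K x - cst) * dens_int K x / K + y / K <= 0); [|nra].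
    replace (_ + _) with (((1 + K) * (flux K x - cst) * dens_int K x + y) * / K) by (unfold Rdiv; ring).
    assert (0 < / K) by (apply Rinv_0_lt_compat; lra).
    assert ((1 + K) * (flux K x - cst) <= - y) by (unfold y; nra).
    assert ((1 + K) * (flux K x - cst) * dens_int K x <= - y)
      by (generalize dependent ((1 + K) * (flux K x - cst)); intros; nra).
    nra. }
rewrite Hf1, Hf2, Hc2 in HV.
assert (A * X = A * Rpower c1 rho + Rabs (wslope K d1) + 1) by (unfold X; field; lra).
pose proof (Rle_abs (wslope K d1)). lra.
Qed.

Lemma scaled_period_unimodal K : 1 < K -> K + 2 * sqrt K < 5 ->
  exists ds, 0 < ds /\ orbit K ds /\
    (forall a b, 0 < a < b -> b <= ds -> scaled_period K a < scaled_period K b) /\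
    (forall a b, orbit K b -> ds <= a < b -> scaled_period K b < scaled_period K a).
Proof.
intros HK HK2.
destruct (sqrt_K K) as [Hk Hk2]; [lra|].
assert (Ho : orbit K 0).
{ unfold orbit, mid. rewrite Rabs_R0.
  replace (rad K 0) with (sqrt K) by (unfold rad; f_equal; ring). nra. }
pose proof (orbit_lt4 _ _ Ho (Rle_refl _)) as HK4.
set (cst := 2/27 * (K - 1)^2 * (4 - K) / (1 + K)).
pose proof (orbit_facts _ _ Ho) as F0.
assert (Hcst : 0 < cst).
{ apply Rdiv_lt_0_compat; [|lra]. repeat apply Rmult_lt_0_compat; lra. }
assert (Hex : forall c, excess K c = (1 + K) * (c - cst)).
{ intros c. unfold excess, cst. field. lra. }
assert (Hcst0 : cst < flux K 0).
{ pose proof (excess_0 K Ho) as E. pose proof (excess_0_factor K Ho) as Hf. rewrite Hex in E.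
  assert (0 < (1 + K) * (flux K 0 - cst)) by (rewrite E; repeat apply Rmult_lt_0_compat; lra).
  nra. }
(* At dY the excess changes sign: [wslope] rises from 0 up to dY and falls afterwards, so its
   positive zero lies beyond dY and is unique. *)
destruct (flux_surj K cst) as [dY [HdY [HoY HfY]]]; trivial; [lra|].
assert (Hpos : forall x, 0 <= x < dY -> 0 < excess K (flux K x)).
{ intros x Hx. rewrite Hex. pose proof (flux_decr K x dY HoY ltac:(lra)). nra. }
assert (Hneg : forall x, orbit K x -> dY < x -> excess K (flux K x) < 0).
{ intros x Hox Hx. rewrite Hex. pose proof (flux_decr K dY x Hox ltac:(lra)). nra. }
assert (HW1 : forall x, 0 < x <= dY -> 0 < wslope K x).
{ intros x Hx. rewrite <- (wslope_0 K Ho). apply wslope_incr; try lra.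
  - apply (orbit_le K x dY HoY); lra.
  - intros z Hz. apply Hpos; lra. }
destruct (wslope_takes_neg K HK Ho) as [d0 [Hd0 [Hod0 HW0]]].
assert (HY0 : dY < d0).
{ destruct (Rle_lt_dec d0 dY) as [H|]; trivial. specialize (HW1 d0 ltac:(lra)). lra. }
destruct (IVT_interv (fun x => - wslope K x) dY d0) as [ds [Hs1 Hs2]]; trivial.
{ intros x Hx. apply continuity_pt_opp, continuity_pt_wslope. apply (orbit_le K x d0 Hod0); lra. }
{ specialize (HW1 dY ltac:(lra)). simpl; lra. }
{ lra. }
simpl in Hs2.
assert (Hods : orbit K ds) by (apply (orbit_le K ds d0 Hod0); lra).
assert (HsY : dY < ds).
{ destruct (Req_dec ds dY) as [->|]; [|lra]. specialize (HW1 dY ltac:(lra)). lra. }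
exists ds. split; [lra|]. split; [trivial|]. split.
- intros a b Hab Hb. apply scaled_period_incr; [apply (orbit_le K b ds Hods); lra|lra|].
  intros x Hx. assert (Hox : orbit K x) by (apply (orbit_le K x ds Hods); lra).
  apply slope_pos_iff; trivial.
  destruct (Rle_lt_dec x dY) as [H|H]; [apply HW1; lra|].
  assert (wslope K ds < wslope K x); [|lra].
  apply wslope_decr; trivial; [lra|]. intros z Hz. apply Hneg; [|lra].
  apply (orbit_le K z ds Hods); lra.
- intros a b Hb Hab. apply scaled_period_decr; trivial; [lra|].
  intros x Hx. assert (Hox : orbit K x) by (apply (orbit_le K x b Hb); lra).
  apply slope_neg_iff; trivial.
  assert (wslope K x < wslope K ds); [|lra].
  apply wslope_decr; trivial; [lra|]. intros z Hz. apply Hneg; [|lra].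
  apply (orbit_le K z x Hox); lra.
Qed.

(** * The improper integral under a cosine substitution *)

Lemma acos_near_1 e : 0 < e -> exists dl, 0 < dl /\ forall x, 1 - dl < x <= 1 -> -1 <= x -> 0 <= acos x < e.
Proof.
intros He. set (e' := Rmin e 1). assert (He' : 0 < e' <= 1 /\ e' <= e).
{ unfold e'. pose proof (Rmin_l e 1); pose proof (Rmin_r e 1). repeat split; trivial.
  apply Rmin_glb_lt; lra. }
pose proof PI2_1 as HPI. exists (1 - cos e'). split.
- rewrite <- cos_0. assert (cos e' < cos 0); [|lra]. apply cos_decreasing_1; lra.
- intros x Hx Hx'. pose proof (acos_bound x). split; [lra|].
  destruct (Rlt_le_dec (acos x) e') as [|H1]; [lra|]. exfalso.
  assert (cos (acos x) <= cos e') by (apply cos_decr_1; lra).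
  rewrite cos_acos in H0 by lra. lra.
Qed.

Lemma acos_near_m1 e : 0 < e -> exists dl, 0 < dl /\
  forall x, -1 <= x < -1 + dl -> x <= 1 -> PI - e < acos x <= PI.
Proof.
intros He. destruct (acos_near_1 e He) as [dl [Hdl H]]. exists dl. split; trivial.
intros x Hx Hx'. specialize (H (- x) ltac:(lra) ltac:(lra)). rewrite acos_opp in H. lra.
Qed.

(** The substitution u = m - r cos t absorbs the singularities of f at the turning points into the
    factor sin t. Convergence follows from the continuity of the primitive of h and of acos at 1 and
    -1. *)
Lemma is_RInt_gen_cos (f h : R -> R) m r : 0 < r ->
  (forall t, continuous h t) ->
  (forall u, m - r < u < m + r -> continuous f u) ->
  (forall t, 0 < t < PI -> r * sin t * f (m - r * cos t) = h t) ->
  is_RInt_gen f (at_right (m - r)) (at_left (m + r)) (RInt h 0 PI).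
Proof.
intros Hr Hh Hf Hfh. pose proof PI_RGT_0 as HPI.
set (th := fun u => acos ((m - u) / r)).
assert (Hth : forall u, m - r < u < m + r -> 0 < th u < PI /\ m - r * cos (th u) = u).
{ intros u Hu. assert (H : -1 < (m - u) / r < 1).
  { split; [apply Rlt_div_r|apply Rlt_div_l]; lra. }
  split; [now apply acos_bound_lt|]. unfold th. rewrite cos_acos by lra. field. lra. }
assert (Hint : forall u v, m - r < u < m + r -> m - r < v < m + r ->
  is_RInt f u v (RInt h (th u) (th v))).
{ intros u v Hu Hv. destruct (Hth u Hu) as [Hu1 Hu2]. destruct (Hth v Hv) as [Hv1 Hv2].
  assert (Hin : forall t, Rmin (th u) (th v) <= t <= Rmax (th u) (th v) -> 0 < t < PI).
  { intros t Ht. split.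
    - apply Rlt_le_trans with (2 := proj1 Ht). apply Rmin_glb_lt; lra.
    - apply Rle_lt_trans with (1 := proj2 Ht). apply Rmax_lub_lt; lra. }
  assert (E : RInt h (th u) (th v) = RInt f u v).
  { apply is_RInt_unique. rewrite <- Hu2 at 2. rewrite <- Hv2 at 2.
    eapply is_RInt_ext; [|apply (is_RInt_comp f (fun t => m - r * cos t) (fun t => r * sin t))].
    - intros t Ht. unfold scal; simpl; unfold mult; simpl. apply Hfh, Hin. lra.
    - intros t Ht. apply Hin in Ht. apply Hf.
      assert (-1 < cos t < 1); [|nra]. split.
      + rewrite <- cos_PI. apply cos_decreasing_1; lra.
      + rewrite <- cos_0. apply cos_decreasing_1; lra.
    - intros t _. split.
      + auto_derive; trivial. ring.
      + apply (cts_mult (fun _ => r) sin); [apply continuous_const|apply continuous_sin]. }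
  rewrite E. apply (RInt_correct (V := R_CompleteNormedModule)).
  apply (ex_RInt_continuous (V := R_CompleteNormedModule)). intros z Hz. apply Hf. split.
  - apply Rlt_le_trans with (2 := proj1 Hz). apply Rmin_glb_lt; lra.
  - apply Rle_lt_trans with (1 := proj2 Hz). apply Rmax_lub_lt; lra. }
set (H := (fun x => RInt h 0 x) : R -> R).
assert (HH : forall x, continuous H x).
{ intros x. apply @ex_derive_continuous. exists (h x).
  apply (is_derive_RInt (V := R_NormedModule) h H 0 x); [|apply Hh].
  apply filter_forall. intros y.
  apply (RInt_correct (V := R_CompleteNormedModule)), ex_RInt_cts, Hh. }
intros P [e He].
assert (He2 : 0 < e / 2) by (pose proof (cond_pos e); lra).
destruct (HH 0 (ball (H 0) (mkposreal _ He2)) (locally_ball _ _)) as [e0 He0].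
destruct (HH PI (ball (H PI) (mkposreal _ He2)) (locally_ball _ _)) as [e1 He1].
destruct (acos_near_1 e0 (cond_pos e0)) as [d0 [Hd0 A0]].
destruct (acos_near_m1 e1 (cond_pos e1)) as [d1 [Hd1 A1]].
apply (Filter_prod _ _ _ (fun u => m - r < u < m + r /\ ball (H 0) (e/2) (H (th u)))
  (fun v => m - r < v < m + r /\ ball (H PI) (e/2) (H (th v)))).
- assert (Hp : 0 < Rmin (2 * r) (r * d0)) by (apply Rmin_glb_lt; nra).
  exists (mkposreal _ Hp). intros u Hu Hu2. apply Rabs_def2 in Hu. unfold minus, plus, opp in Hu; simpl in Hu.
  pose proof (Rmin_l (2 * r) (r * d0)). pose proof (Rmin_r (2 * r) (r * d0)).
  assert (Hur : m - r < u < m + r) by lra. split; trivial. apply He0.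
  assert (0 <= th u < e0).
  { apply A0; [split|]; [apply Rlt_div_r|apply Rle_div_l|apply Rle_div_r]; nra. }
  apply Rabs_def1; unfold minus, plus, opp; simpl; lra.
- assert (Hp : 0 < Rmin (2 * r) (r * d1)) by (apply Rmin_glb_lt; nra).
  exists (mkposreal _ Hp). intros u Hu Hu2. apply Rabs_def2 in Hu. unfold minus, plus, opp in Hu; simpl in Hu.
  pose proof (Rmin_l (2 * r) (r * d1)). pose proof (Rmin_r (2 * r) (r * d1)).
  assert (Hur : m - r < u < m + r) by lra. split; trivial. apply He1.
  assert (PI - e1 < th u <= PI).
  { apply A1; [split|]; [apply Rle_div_r|apply Rlt_div_l|apply Rle_div_l]; nra. }
  apply Rabs_def1; unfold minus, plus, opp; simpl; lra.
- intros u v [Hu Bu] [Hv Bv]. simpl. exists (RInt h (th u) (th v)). split; [now apply Hint|].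
  apply He.
  assert (E : H (th u) + RInt h (th u) (th v) = H (th v)).
  { apply (RInt_Chasles (V := R_CompleteNormedModule)); apply ex_RInt_cts, Hh. }
  apply Rabs_def2 in Bu. apply Rabs_def2 in Bv.
  unfold minus, plus, opp in Bu, Bv; simpl in Bu, Bv.
  assert (H 0 = 0) by exact (RInt_point (V := R_CompleteNormedModule) 0 h).
  change (RInt h 0 PI) with (H PI).
  apply Rabs_def1; unfold minus, plus, opp; simpl; lra.
Qed.

(** With y = [wave], the quantity under the root is (a d sin t / [wave])^2 times [wave * gap]. Its
    square factor cancels the differential a d sin t dt, leaving [wave * dens], and the scale a
    drops out. *)
Lemma period_eq_scaled_period C1 C2 C3 b a K d : 0 < a -> orbit K d -> 0 < d ->
  phi_minus C1 C2 C3 b = C1 - a * (mid K d + d) ->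
  phi_plus C1 C2 C3 b = C1 - a * (mid K d - d) ->
  (forall y, 0 < y -> 2 * (b - U C1 C2 C3 (C1 - a * y))
     = a^2 * ((mid K d + d - y) * (y - (mid K d - d)) * (rad K d + mid K d - y)) / y) ->
  period C1 C2 C3 b = scaled_period K d.
Proof.
intros Ha Ho Hd Hm Hp HU. pose proof (orbit_bounds _ _ Ho) as Hb.
unfold period, scaled_period. f_equal. apply is_RInt_gen_unique.
rewrite Hm, Hp.
replace (C1 - a * (mid K d + d)) with (C1 - a * mid K d - a * d) by ring.
replace (C1 - a * (mid K d - d)) with (C1 - a * mid K d + a * d) by ring.
apply is_RInt_gen_cos.
- nra.
- intros t. apply (cts_angle (fun d t => wave K d t * dens K d t)). now cts.
- intros u Hu. set (y := (C1 - u) / a).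
  assert (Ey : u = C1 - a * y) by (unfold y; field; lra).
  assert (Hy : mid K d - d < y < mid K d + d).
  { unfold y. split; [apply Rlt_div_r|apply Rlt_div_l]; nra. }
  assert (HU2 : 0 < 2 * (b - U C1 C2 C3 u)).
  { rewrite Ey, HU by lra. repeat apply Rmult_lt_0_compat; try lra.
    apply Rinv_0_lt_compat; lra. }
  assert (u - C1 <> 0) by nra.
  assert (D : ex_derive (U C1 C2 C3) u) by (unfold U; auto_derive; lra).
  apply (ex_derive_continuous (fun phi => 1 / sqrt (2 * (b - U C1 C2 C3 phi)))).
  set (V := U C1 C2 C3) in *. clearbody V. auto_derive.
  pose proof (sqrt_lt_R0 _ HU2). repeat split; trivial. apply Rgt_not_eq. trivial.
- intros t Ht. pose proof (orbit_pos _ _ t Ho) as [Hw Hg].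
  assert (Hs : 0 < sin t) by (apply sin_gt_0; lra).
  replace (C1 - a * mid K d - a * d * cos t) with (C1 - a * wave K d t) by (unfold wave; ring).
  rewrite HU by trivial.
  replace (a^2 * _ / _) with ((a * d * sin t / wave K d t)^2 * (wave K d t * gap K d t)).
  + rewrite sqrt_mult by nra. rewrite sqrt_pow2.
    * unfold dens. field. repeat split; try lra. apply Rgt_not_eq, sqrt_lt_R0. nra.
    * apply Rlt_le. repeat apply Rmult_lt_0_compat; try lra. now apply Rinv_0_lt_compat.
  + replace ((mid K d + d - wave K d t) * (wave K d t - (mid K d - d)))
      with (d^2 * (sin t)^2).
    * replace (rad K d + mid K d - wave K d t) with (gap K d t) by (unfold gap, wave; ring).
      field. lra.
    * pose proof (sin2_cos2 t) as E. unfold Rsqr in E. unfold wave.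
      replace ((sin t)^2) with (1 - cos t * cos t) by lra. ring.
Qed.

(** * Passage between the original parameters and the half-width *)

(** Decreasing in b. The bounds of the three cases, in increasing b, become K = 4, 7 - 2 sqrt 6, 1
    and 0. *)
Definition level (C1 C2 b : R) : R := 4 - 6 * (b + C1^2 / 2 + C1 * C2) / (C1 + C2/2)^2.
Definition cubic (K c y : R) : R := y^3 - 2 * y^2 + (4 - K) / 3 * y - c.

Lemma U_cubic C1 C2 C3 b y : 0 < 2 * C1 + C2 -> y <> 0 ->
  2 * (b - U C1 C2 C3 (C1 - (C1 + C2/2) * y))
  = (C1 + C2/2)^2 * cubic (level C1 C2 b) (C3 / (C1 + C2/2)^3) y / y.
Proof.
intros Ha Hy. unfold U, cubic, level. set (a := C1 + C2/2).
assert (Ha0 : 0 < a) by (unfold a; lra).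
assert (E : C2 = 2 * (a - C1)) by (unfold a; field).
assert (Hay : a * y <> 0) by (apply Rmult_integral_contrapositive; split; lra).
clearbody a. rewrite E. field. repeat split; trivial; try lra.
Qed.

Lemma exists_root (f : R -> R) x y : (forall z, ex_derive f z) -> x < y ->
  f x < 0 < f y -> exists z, x < z < y /\ f z = 0.
Proof.
intros Hf Hxy [H1 H2]. destruct (IVT_interv f x y) as [z [Hz1 Hz2]]; trivial.
- intros z _. apply continuity_pt_filterlim, (ex_derive_continuous f), Hf.
- exists z. split; trivial.
  assert (z <> x) by (intros ->; lra). assert (z <> y) by (intros ->; lra). lra.
Qed.

(** [cubicF] vanishes at -C2/2 and at C1 and equals [C3crit] at (C1 - C2)/3, so the intermediate
    value theorem supplies the witness for [epsilon] here and in [phi2_spec]. *)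
Lemma phi1_spec C1 C2 C3 : 0 < 2 * C1 + C2 -> 0 < C3 < C3crit C1 C2 ->
  - C2/2 < phi1 C1 C2 C3 < (C1 - C2)/3 /\ cubicF C1 C2 (phi1 C1 C2 C3) = C3.
Proof.
intros Ha [H0 H1]. unfold phi1. apply epsilon_spec.
destruct (exists_root (fun p => cubicF C1 C2 p - C3) (- C2/2) ((C1 - C2)/3)) as [z Hz].
- intros z. unfold cubicF. now auto_derive.
- lra.
- unfold cubicF, C3crit in *. nra.
- exists z. lra.
Qed.

Lemma phi2_spec C1 C2 C3 : 0 < 2 * C1 + C2 -> 0 < C3 < C3crit C1 C2 ->
  (C1 - C2)/3 < phi2 C1 C2 C3 < C1 /\ cubicF C1 C2 (phi2 C1 C2 C3) = C3.
Proof.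
intros Ha [H0 H1]. unfold phi2. apply epsilon_spec.
destruct (exists_root (fun p => C3 - cubicF C1 C2 p) ((C1 - C2)/3) C1) as [z Hz].
- intros z. unfold cubicF. now auto_derive.
- lra.
- unfold cubicF, C3crit in *. nra.
- exists z. lra.
Qed.

(** Admissibility fixes the signs of the cubic: negative at 0, positive at y2, negative at y1. This
    places a root in each of (0, y2) and (y2, y1), namely the images of [phi_plus] and [phi_minus];
    the third root follows from the sum 2. *)
Lemma admissible_orbit C1 C2 b C3 : 0 < 2 * C1 + C2 -> admissible C1 C2 b C3 ->
  exists d, 0 < d /\ orbit (level C1 C2 b) d
    /\ C3 = (C1 + C2/2)^3 * flux (level C1 C2 b) d
    /\ period C1 C2 C3 b = scaled_period (level C1 C2 b) d.
Proof.
intros Ha [HC3 Hb].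
pose proof (phi1_spec _ _ _ Ha HC3) as [H1 H1'].
pose proof (phi2_spec _ _ _ Ha HC3) as [H2 H2'].
unfold b_minus, b_plus in Hb.
set (a := C1 + C2/2). assert (Ha0 : 0 < a) by (unfold a; lra).
pose proof (fun y => U_cubic C1 C2 C3 b y Ha) as HU. fold a in HU.
set (K := level C1 C2 b) in *. set (c := C3 / a^3) in *.
assert (Ha3 : 0 < a^3) by now apply pow_lt.
assert (Hc : 0 < c) by (apply Rdiv_lt_0_compat; lra).
set (y1 := (C1 - phi1 C1 C2 C3) / a). set (y2 := (C1 - phi2 C1 C2 C3) / a).
assert (E1 : phi1 C1 C2 C3 = C1 - a * y1) by (unfold y1; field; lra).
assert (E2 : phi2 C1 C2 C3 = C1 - a * y2) by (unfold y2; field; lra).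
assert (Hy1 : y2 < y1) by (unfold a in *; nra).
assert (Hy2 : 0 < y2) by nra.
assert (Hsgn : forall y, 0 < y -> exists k, 0 < k /\
   2 * (b - U C1 C2 C3 (C1 - a * y)) = k * cubic K c y).
{ intros y Hy. exists (a^2 / y). split; [apply Rdiv_lt_0_compat; nra|].
  rewrite HU by lra. field. lra. }
assert (Q2 : 0 < cubic K c y2).
{ destruct (Hsgn y2) as [k [Hk Ek]]; trivial. rewrite <- E2 in Ek. nra. }
assert (Q1 : cubic K c y1 < 0).
{ destruct (Hsgn y1) as [k [Hk Ek]]; [lra|]. rewrite <- E1 in Ek. nra. }
assert (Hroot : forall y, 0 < y -> U C1 C2 C3 (C1 - a * y) = b <-> cubic K c y = 0).
{ intros y Hy. destruct (Hsgn y Hy) as [k [Hk Ek]]. split; intros E.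
  - rewrite E in Ek. nra.
  - rewrite E in Ek. lra. }
assert (Sm : phi1 C1 C2 C3 < phi_minus C1 C2 C3 b < phi2 C1 C2 C3
             /\ U C1 C2 C3 (phi_minus C1 C2 C3 b) = b).
{ unfold phi_minus. apply epsilon_spec.
  destruct (exists_root (fun y => - cubic K c y) y2 y1) as [z [Hz1 Hz2]]; try lra.
  - intros z. unfold cubic. now auto_derive.
  - exists (C1 - a * z). rewrite E1, E2. split; [nra|]. apply Hroot; lra. }
assert (Sp : phi2 C1 C2 C3 < phi_plus C1 C2 C3 b < C1
             /\ U C1 C2 C3 (phi_plus C1 C2 C3 b) = b).
{ unfold phi_plus. apply epsilon_spec.
  destruct (exists_root (cubic K c) 0 y2) as [z [Hz1 Hz2]]; try lra.
  - intros z. unfold cubic. now auto_derive.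
  - split; trivial. unfold cubic. lra.
  - exists (C1 - a * z). rewrite E2. split; [nra|]. apply Hroot; lra. }
set (x1 := (C1 - phi_plus C1 C2 C3 b) / a). set (x2 := (C1 - phi_minus C1 C2 C3 b) / a).
assert (F1 : phi_plus C1 C2 C3 b = C1 - a * x1) by (unfold x1; field; lra).
assert (F2 : phi_minus C1 C2 C3 b = C1 - a * x2) by (unfold x2; field; lra).
assert (Hx1 : 0 < x1 < y2) by (split; nra).
assert (Hx2 : y2 < x2 < y1) by (split; nra).
assert (R1 : cubic K c x1 = 0) by (apply Hroot; [lra|]; now rewrite <- F1).
assert (R2 : cubic K c x2 = 0) by (apply Hroot; [lra|]; now rewrite <- F2).
set (s := (x1 + x2) / 2). set (d := (x2 - x1) / 2).
(* Subtracting the two root equations and dividing by x2 - x1 eliminates c. *)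
assert (HK : K = (2 - 3 * s)^2 + 3 * d^2).
{ assert (E : (x2 - x1) * (K - ((2 - 3 * s)^2 + 3 * d^2)) = 0).
  { transitivity (-3 * (cubic K c x2 - cubic K c x1)); [unfold cubic, s, d; field|].
    rewrite R1, R2; ring. }
  apply Rmult_integral in E. destruct E; lra. }
assert (Hcub : forall y, cubic K c y = (s + d - y) * (y - (s - d)) * (2 - 2 * s - y)).
{ intros y. transitivity (cubic K c y - cubic K c x1); [rewrite R1; ring|].
  unfold cubic. rewrite HK. unfold s, d. field. }
(* The cubic is negative at y1, which lies above x2, so the third root is beyond y1. *)
assert (Hx3 : y1 < 2 - 2 * s).
{ destruct (Rlt_le_dec y1 (2 - 2 * s)) as [|H]; trivial. exfalso.
  rewrite Hcub in Q1.
  assert (0 <= (y1 - (s + d)) * (y1 - (s - d)) * (y1 - (2 - 2 * s))); [|lra].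
  repeat apply Rmult_le_pos; unfold s, d in *; lra. }
assert (Hd : 0 < d) by (unfold d; lra).
assert (Hr : rad K d = 2 - 3 * s).
{ unfold rad. rewrite HK. replace (_ - _) with ((2 - 3 * s)^2) by ring.
  apply sqrt_pow2. unfold s, d in *; lra. }
assert (Hm : mid K d = s) by (unfold mid; rewrite Hr; field).
assert (Ho : orbit K d).
{ unfold orbit. rewrite Rabs_pos_eq, Hr, Hm by lra. unfold s, d in *; lra. }
exists d. split; [trivial|]. split; [trivial|]. split.
- assert (Ec : flux K d = c).
  { transitivity (- cubic K c 0); [|unfold cubic; ring]. rewrite Hcub.
    unfold flux, half_sum. rewrite Hr, Hm. field. }
  rewrite Ec. unfold c. field. lra.
- apply (period_eq_scaled_period C1 C2 C3 b a); trivial.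
  + rewrite Hm, F2. unfold s, d. field.
  + rewrite Hm, F1. unfold s, d. field.
  + intros y Hy. rewrite HU, Hcub, Hr, Hm by lra. field. lra.
Qed.

(* The condition on y says that y is a critical point of P(y)/y, P being the cubic with roots
   x1, x2, x3; 2/3 is the mean of the roots. *)
Lemma critical_signs x1 x2 x3 y : 0 < x1 < x2 -> x2 < x3 -> x1 + x2 + x3 = 2 -> 0 < y ->
  2 * y^2 * (1 - y) = x1 * x2 * x3 ->
  (y < 2/3 -> 0 < (y - x1) * (y - x2) * (y - x3)) /\
  (2/3 < y -> (y - x1) * (y - x2) * (y - x3) < 0).
Proof.
intros H12 H23 Hs Hy Hc.
assert (Hx3 : x3 = 2 - x1 - x2) by lra. subst x3.
set (u := y - x1). set (v := y - x2). set (w := y - (2 - x1 - x2)).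
(* With P = u v w this says y P'(y) = P(y). Multiplied by u it becomes [E']: for u <> 0 the sign of
   P(y) is opposite to that of v + w. *)
assert (E : y * (u * v + v * w + w * u) = u * v * w) by (unfold u, v, w; lra).
assert (E' : y * (u^2 * (v + w)) + x1 * (u * v * w) = 0).
{ replace x1 with (y - u) by (unfold u; ring).
  assert (u * (u * v * w) = u * (y * (u * v + v * w + w * u))) by (now rewrite E). lra. }
assert (Huv : v < u) by (unfold u, v; lra). assert (Hvw : w < v) by (unfold v, w; lra).
assert (Hsum : u + v + w = 3 * y - 2) by (unfold u, v, w; lra).
clearbody u v w.
split; intros Hy3.
- destruct (Rlt_le_dec 0 (u * v * w)) as [|H]; trivial. exfalso.
  assert (Hw : w < 0) by lra.
  destruct (Rle_lt_dec u 0) as [Hu|Hu].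
  + assert (0 < v * w) by nra. assert (0 <= u * v) by nra. assert (0 <= w * u) by nra.
    assert (0 < y * (u * v + v * w + w * u)) by (apply Rmult_lt_0_compat; lra). lra.
  + assert (0 < u^2) by nra. assert (u^2 * (v + w) < 0) by nra.
    assert (x1 * (u * v * w) <= 0) by nra. nra.
- destruct (Rlt_le_dec (u * v * w) 0) as [|H]; trivial. exfalso.
  assert (Hu : 0 < u) by lra.
  destruct (Rle_lt_dec 0 w) as [Hw|Hw].
  + assert (0 < u^2) by nra. assert (0 < u^2 * (v + w)) by nra.
    assert (0 <= x1 * (u * v * w)) by nra. nra.
  + assert (Hv : v <= 0).
    { destruct (Rle_lt_dec v 0) as [|Hv]; trivial. exfalso.
      assert (0 < u * v) by nra. nra. }
    assert (0 <= u * v + v * w + w * u).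
    { destruct (Rle_lt_dec 0 (u * v + v * w + w * u)) as [|Hn]; trivial. exfalso. nra. }
    (* Here u > -(v + w) > 0, while v w <= (v + w)^2, so the sum of pairwise products would be
       negative. *)
    assert (u * (v + w) < - (v + w) * (v + w)) by nra. nra.
Qed.

(** Makes the maximum point of case (ii) admissible. In the variable y, [phi1] and [phi2] are
    critical points of P(y)/y on either side of 2/3, so [critical_signs] compares b with both values
    of U. *)
Lemma orbit_admissible C1 C2 b d : 0 < 2 * C1 + C2 -> 0 < d -> orbit (level C1 C2 b) d ->
  admissible C1 C2 b ((C1 + C2/2)^3 * flux (level C1 C2 b) d).
Proof.
intros Ha Hd Ho. set (a := C1 + C2/2). assert (Ha0 : 0 < a) by (unfold a; lra).
set (K := level C1 C2 b) in *. set (C3 := a^3 * flux K d).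
assert (Ha3 : 0 < a^3) by now apply pow_lt.
pose proof (orbit_facts _ _ Ho) as F.
assert (HC3 : 0 < C3 < C3crit C1 C2).
{ split; [apply Rmult_lt_0_compat; lra|].
  replace (C3crit C1 C2) with (a^3 * (8/27)) by (unfold C3crit, a; field).
  apply Rmult_lt_compat_l; trivial.
  assert (Ho0 : orbit K 0) by (apply (orbit_le K 0 d Ho); lra).
  (* [C3crit] is a^3 8/27, and 8/27 exceeds the central value by 2/27 k^2 (3 - k), with k = sqrt
     K. *)
  apply Rlt_trans with (flux K 0); [apply flux_decr; trivial; lra|].
  rewrite flux_0 by trivial. destruct (sqrt_K K) as [Hk Hk2]; [lra|].
  assert (K < 4) by (apply (orbit_lt4 _ _ Ho); lra).
  assert (0 < sqrt K ^ 2 * (3 - sqrt K)) by (apply Rmult_lt_0_compat; nra). nra. }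
split; trivial.
pose proof (phi1_spec _ _ _ Ha HC3) as [H1 H1'].
pose proof (phi2_spec _ _ _ Ha HC3) as [H2 H2'].
unfold b_minus, b_plus.
pose proof (fun y => U_cubic C1 C2 C3 b y Ha) as HU. fold a K in HU.
replace (C3 / a^3) with (flux K d) in HU by (unfold C3; field; lra).
pose proof (orbit_bounds _ _ Ho) as Hb.
assert (Hcub : forall y, cubic K (flux K d) y
   = (y - (mid K d - d)) * (y - (mid K d + d)) * (y - (rad K d + mid K d))).
{ intros y. unfold cubic. pose proof (orbit_rad _ _ Ho) as [_ Hr2].
  replace K with (rad K d ^ 2 + 3 * d ^2) at 1 by lra. unfold flux, half_sum, mid. field. }
assert (Hcrit : forall p, cubicF C1 C2 p = C3 ->
   2 * ((C1 - p) / a)^2 * (1 - (C1 - p) / a) = flux K d).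
{ intros p Hp. apply Rmult_eq_reg_l with (a^3); [|lra]. fold C3. rewrite <- Hp.
  unfold cubicF. replace (C2/2) with (a - C1) by (unfold a; ring). field. lra. }
assert (Hflux : flux K d = (mid K d - d) * (mid K d + d) * (rad K d + mid K d))
  by (unfold flux, half_sum, mid; field).
assert (Hsum : mid K d - d + (mid K d + d) + (rad K d + mid K d) = 2) by (unfold mid; field).
assert (Hsgn : forall p, p < C1 -> exists k, 0 < k /\
   2 * (b - U C1 C2 C3 p) = k * cubic K (flux K d) ((C1 - p) / a)).
{ intros p Hp. assert (Hy : 0 < (C1 - p) / a) by (apply Rdiv_lt_0_compat; lra).
  exists (a^2 / ((C1 - p) / a)). split; [apply Rdiv_lt_0_compat; nra|].
  replace p with (C1 - a * ((C1 - p) / a)) at 1 by (field; lra).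
  rewrite HU by lra. field. lra. }
split.
- set (p := phi2 C1 C2 C3) in *.
  assert (Hy : 0 < (C1 - p) / a < 2/3).
  { split; [apply Rdiv_lt_0_compat; lra|apply Rlt_div_l; unfold a; lra]. }
  destruct (Hsgn p) as [k [Hk Ek]]; [lra|]. rewrite Hcub in Ek.
  pose proof (Hcrit p H2') as Hc. rewrite Hflux in Hc.
  destruct (critical_signs (mid K d - d) (mid K d + d) (rad K d + mid K d) ((C1 - p)/a))
    as [Hs _]; trivial; try lra.
  specialize (Hs ltac:(lra)). nra.
- set (p := phi1 C1 C2 C3) in *.
  assert (Hy : 2/3 < (C1 - p) / a) by (apply (Rlt_div_r (2/3) (C1 - p) a); unfold a; lra).
  destruct (Hsgn p) as [k [Hk Ek]]; [lra|]. rewrite Hcub in Ek.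
  pose proof (Hcrit p H1') as Hc. rewrite Hflux in Hc.
  destruct (critical_signs (mid K d - d) (mid K d + d) (rad K d + mid K d) ((C1 - p)/a))
    as [_ Hs]; trivial; try lra.
  specialize (Hs ltac:(lra)). nra.
Qed.

(** * Thresholds in b and conclusion *)

Lemma orbit_order K a d d' : 0 < a -> 0 < d -> orbit K d' ->
  a * flux K d < a * flux K d' -> d' < d.
Proof.
intros Ha Hd Ho' H. destruct (Rlt_le_dec d' d) as [|[H'| <-]]; [trivial| |lra].
pose proof (flux_decr K d d' Ho' ltac:(lra)). nra.
Qed.

(** [b_1] corresponds to K = 7 - 2 sqrt 6 = (sqrt 6 - 1)^2, where K + 2 sqrt K = 5. *)
Lemma level_bounds C1 C2 b : 0 < 2 * C1 + C2 ->
  (b < b_1 C1 C2 -> 5 < level C1 C2 b + 2 * sqrt (level C1 C2 b)) /\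
  (b_1 C1 C2 < b -> b < (C2^2 - 4 * C1 * C2) / 8 ->
     1 < level C1 C2 b /\ level C1 C2 b + 2 * sqrt (level C1 C2 b) < 5) /\
  ((C2^2 - 4 * C1 * C2) / 8 < b -> level C1 C2 b < 1).
Proof.
intros Ha. set (a := C1 + C2/2). assert (Ha2 : 0 < a^2) by (apply pow_lt; unfold a; lra).
assert (E6 : sqrt 6 ^ 2 = 6) by (apply pow2_sqrt; lra).
assert (H6 : 2 < sqrt 6) by (rewrite <- (sqrt_pow2 2) by lra; apply sqrt_lt_1; lra).
assert (Hl : level C1 C2 b * a^2 = 4 * a^2 - 6 * (b + C1^2/2 + C1 * C2)).
{ unfold level. fold a. field. intros E; rewrite E in Ha2; lra. }
assert (Hb1 : 6 * (b_1 C1 C2 + C1^2/2 + C1 * C2) = (2 * sqrt 6 - 3) * a^2).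
{ unfold b_1, a. field. }
assert (Hb2 : 6 * ((C2^2 - 4 * C1 * C2) / 8 + C1^2/2 + C1 * C2) = 3 * a^2).
{ unfold a. field. }
set (K := level C1 C2 b) in *.
split; [|split].
- intros Hb. assert (HK : 7 - 2 * sqrt 6 < K) by nra.
  assert (sqrt 6 - 1 < sqrt K); [|lra].
  rewrite <- (sqrt_pow2 (sqrt 6 - 1)) by lra. apply sqrt_lt_1_alt. split; [apply pow2_ge_0|lra].
- intros Hb Hb'. assert (HK : K < 7 - 2 * sqrt 6) by nra.
  assert (HK1 : 1 < K) by nra. split; trivial.
  assert (sqrt K < sqrt 6 - 1); [|lra].
  rewrite <- (sqrt_pow2 (sqrt 6 - 1)) by lra. apply sqrt_lt_1_alt. split; [lra|lra].
- intros Hb. nra.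
Qed.

Theorem theorem3 (C1 C2 : R) (hC : 2 * C1 + C2 > 0) :
  (forall b, - (1/2) * C1^2 - C1 * C2 < b < b_1 C1 C2 ->
     forall C3 C3', admissible C1 C2 b C3 -> admissible C1 C2 b C3' -> C3 < C3' ->
       period C1 C2 C3 b < period C1 C2 C3' b)
  /\
  (forall b, b_1 C1 C2 < b < (C2^2 - 4 * C1 * C2) / 8 ->
     exists Cs, admissible C1 C2 b Cs /\
       (forall C3 C3', admissible C1 C2 b C3 -> admissible C1 C2 b C3' ->
          C3 < C3' <= Cs -> period C1 C2 C3 b < period C1 C2 C3' b) /\
       (forall C3 C3', admissible C1 C2 b C3 -> admissible C1 C2 b C3' ->
          Cs <= C3 < C3' -> period C1 C2 C3' b < period C1 C2 C3 b))
  /\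
  (forall b, (C2^2 - 4 * C1 * C2) / 8 < b < (C1 - C2)^2 / 6 ->
     forall C3 C3', admissible C1 C2 b C3 -> admissible C1 C2 b C3' -> C3 < C3' ->
       period C1 C2 C3' b < period C1 C2 C3 b).
Proof.
assert (Ha : 0 < 2 * C1 + C2) by lra.
assert (Ha3 : 0 < (C1 + C2/2)^3) by (apply pow_lt; lra).
split; [|split].
- intros b Hb C3 C3' H H' Hlt. destruct (level_bounds C1 C2 b Ha) as [HK _].
  destruct (admissible_orbit C1 C2 b C3 Ha H) as [d [Hd [Ho [Ec ->]]]].
  destruct (admissible_orbit C1 C2 b C3' Ha H') as [d' [Hd' [Ho' [Ec' ->]]]].
  apply scaled_period_decr_large_K; [apply HK; lra|trivial|]. split; trivial.
  apply (orbit_order (level C1 C2 b) ((C1 + C2/2)^3)); trivial. lra.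
- intros b Hb. destruct (level_bounds C1 C2 b Ha) as [_ [HK _]].
  destruct HK as [HK1 HK2]; try lra.
  destruct (scaled_period_unimodal _ HK1 HK2) as [ds [Hds [Hos [Hinc Hdec]]]].
  exists ((C1 + C2/2)^3 * flux (level C1 C2 b) ds).
  split; [now apply orbit_admissible|].
  split; intros C3 C3' H H' Hlt;
  destruct (admissible_orbit C1 C2 b C3 Ha H) as [d [Hd [Ho [Ec ->]]]];
  destruct (admissible_orbit C1 C2 b C3' Ha H') as [d' [Hd' [Ho' [Ec' ->]]]];
  (assert (Hdd : d' < d)
    by (apply (orbit_order (level C1 C2 b) ((C1 + C2/2)^3)); trivial; lra)).
  + apply Hdec; trivial. split; trivial. apply Rnot_lt_le. intros Hn.
    pose proof (flux_decr (level C1 C2 b) d' ds Hos ltac:(lra)). nra.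
  + apply Hinc; [lra|]. apply Rnot_lt_le. intros Hn.
    pose proof (flux_decr (level C1 C2 b) ds d Ho ltac:(lra)). nra.
- intros b Hb C3 C3' H H' Hlt. destruct (level_bounds C1 C2 b Ha) as [_ [_ HK]].
  destruct (admissible_orbit C1 C2 b C3 Ha H) as [d [Hd [Ho [Ec ->]]]].
  destruct (admissible_orbit C1 C2 b C3' Ha H') as [d' [Hd' [Ho' [Ec' ->]]]].
  apply scaled_period_incr_small_K; [apply HK; lra|trivial|]. split; trivial.
  apply (orbit_order (level C1 C2 b) ((C1 + C2/2)^3)); trivial. lra.
Qed.
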